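(* Let $\lambda,\mu,\nu$ be real parameters, let $T$ be the piecewise fractional linear map of $[0,1]$ with the three inverse branches $V_\lambda,V_\mu,V_\nu$, let $S_1$ be the map with inverse branches $W_\lambda,V_\mu,V_\nu$, let $S_2$ be the map with inverse branches $V_\lambda,W_\mu,V_\nu$, and let $S_3$ be the map with inverse branches $V_\lambda,V_\mu,W_\nu$, where $$V_\lambda(x)=\frac{\lambda x}{3+(3\lambda-3)x},\quad V_\mu(x)=\frac{3+(2\mu-3)x}{9+(3\mu-9)x},\quad V_\nu(x)=\frac{2+(\nu-2)x}{3+(\nu-3)x},$$ $$W_\lambda(x)=\frac{\lambda-\lambda x}{3\lambda+(3-3\lambda)x},\quad W_\mu(x)=\frac{2\mu+(3-2\mu)x}{3\mu+(9-3\mu)x},\quad W_\nu(x)=\frac{\nu+(2-\nu)x}{\nu+(3-\nu)x}.$$ (1) The maps $T$ and $S_1$ both have a natural dual and the same invariant measure if the conditions $\lambda\mu+\mu=\lambda\nu+3\lambda$ and $\lambda\mu\nu+3\lambda\mu+12\mu=9\nu+27$ are satisfied. (2) The maps $T$ and $S_2$ both have a natural dual and the same invariant measure if the conditions $\lambda\mu+\mu=\lambda\nu+3\lambda$ and $\lambda\mu\nu=9$ are satisfied. (3) The maps $T$ and $S_3$ both have a natural dual and the same invariant measure if the conditions $\lambda\mu+\mu=\lambda\nu+3\lambda$ and $4\lambda\nu-\mu\nu-\lambda\mu\nu+3\lambda+3=0$ are satisfied.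
   Context: The partition of $[0,1]$ is $0<\tfrac13<\tfrac23<1$. A map with inverse branches $X_1,X_2,X_3$ is the map $[0,1]\to[0,1]$ which maps each of the intervals $]0,\tfrac13[$, $]\tfrac13,\tfrac23[$, $]\tfrac23,1[$ bijectively onto $]0,1[$, with inverse $X_j$ on the $j$-th interval. The parameters are assumed to be such that the branches have this property and the maps are ergodic and admit a $\sigma$-finite invariant measure. One has $W_\bullet(x)=V_\bullet(1-x)$, so replacing $V_\bullet$ by $W_\bullet$ (''flipping'' the branch) means replacing that branch of $T$ by the corresponding branch of $1-T$. A fractional linear branch $X(x)=\frac{c+dx}{a+bx}$ is associated with the matrix $\begin{pmatrix}a&b\\c&d\end{pmatrix}$; its adjoint is $X^*(y)=\frac{b+dy}{a+cy}$, with the transposed matrix. A dual map of a map $R$ with inverse branches $X_j$ is a piecewise fractional linear map $R^*:B^*\to B^*$ on an interval $B^*$ whose inverse branches are the adjoints $X_j^*$. Then $h(x)=\int_{B^*}\frac{dy}{(1+xy)^2}$ is, up to a multiplicative factor, the density of the invariant measure of $R$; for $B^*=[\eta,\theta]$ this is $h(x)=\frac{\theta}{1+\theta x}-\frac{\eta}{1+\eta x}$. The dual is called natural if there is a map $\psi(t)=\frac{B+Dt}{A+Bt}$ with $\psi\circ R=R^*\circ\psi$, equivalently $\psi\circ X_j=X_j^*\circ\psi$ for all $j$. If $B^*$ shrinks to a point $\xi$ (singular dual), this can also be seen as a natural dual, and the density is $h(x)=\frac{1}{(1+\xi x)^2}$. *)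

(* Defs.v *)
From HB Require Import structures.
From mathcomp Require Import all_boot all_order all_algebra.
From mathcomp Require Import all_classical all_reals all_analysis.

Set Implicit Arguments.
Unset Strict Implicit.
Unset Printing Implicit Defensive.

Import Order.TTheory GRing.Theory Num.Theory.
Import numFieldNormedType.Exports.

Local Open Scope classical_set_scope.
Local Open Scope ring_scope.

Section FractionalLinear.
Context {R : realType}.

Definition mx2 (a b c d : R) : 'M[R]_2 :=
  \matrix_(i < 2, j < 2) (if i == 0 then (if j == 0 then a else b)
                          else (if j == 0 then c else d)).

Definition fl_den (M : 'M[R]_2) (x : R) : R := M 0 0 + M 0 1 * x.

(* The matrix (a b; c d) acts by x |-> (c + d x) / (a + b x), so that the
   adjoint y |-> (b + d y) / (a + c y) is [fl M^T].  As division is total in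
   MathComp, uses of [fl] at a possible pole carry a condition on [fl_den]. *)
Definition fl (M : 'M[R]_2) (x : R) : R :=
  (M 1 0 + M 1 1 * x) / fl_den M x.

Definition V1 (l : R) := mx2 3 (3 * l - 3) 0 l.
Definition V2 (m : R) := mx2 9 (3 * m - 9) 3 (2 * m - 3).
Definition V3 (n : R) := mx2 3 (n - 3) 2 (n - 2).

Definition W1 (l : R) := mx2 (3 * l) (3 - 3 * l) l (- l).
Definition W2 (m : R) := mx2 (3 * m) (9 - 3 * m) (2 * m) (3 - 2 * m).
Definition W3 (n : R) := mx2 n (3 - n) n (2 - n).

Definition branches (X1 X2 X3 : 'M[R]_2) (j : 'I_3) : 'M[R]_2 :=
  tnth [tuple X1; X2; X3] j.

(* [F] maps the interval [B] to itself and maps each piece [J j] bijectively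
   onto the interior of [B], with inverse [fl (X j)].  The values of [F] at the
   points of [B] outside the pieces are left free. *)
Definition has_inverse_branches (B : set R) (J : 'I_3 -> set R)
    (X : 'I_3 -> 'M[R]_2) (F : R -> R) : Prop :=
  set_fun B B F /\
  forall j, [/\ set_bij (J j) B° F,
                (forall y, B° y -> fl_den (X j) y != 0) &
                (forall x, J j x -> fl (X j) (F x) = x)].

Definition third (j : 'I_3) : set R := `](j%:R / 3), (j.+1%:R / 3)[.

Definition unit_map (X : 'I_3 -> 'M[R]_2) (F : R -> R) : Prop :=
  has_inverse_branches `[0, 1] third X F.

(* The pieces of the dual map are open intervals which partition [B] up to
   finitely many points; [B] may be unbounded but not reduced to a point (for
   that case see [singular_dual]). *)
Definition dual_map (X : 'I_3 -> 'M[R]_2) (B : set R) (F : R -> R) : Prop :=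
  [/\ is_interval B, B° !=set0 &
      exists J : 'I_3 -> set R,
        [/\ (forall j, [/\ is_interval (J j), open (J j) & J j `<=` B]),
            trivIset setT J,
            finite_set (B `\` \bigcup_j J j) &
            has_inverse_branches B J (fun j => (X j)^T) F]].

(* The map psi(t) = (b + d t) / (a + b t) is [fl] of a symmetric matrix. *)
Definition natural_dual (X : 'I_3 -> 'M[R]_2) (F : R -> R)
    (B : set R) (F' : R -> R) : Prop :=
  dual_map X B F' /\
  exists a b d : R, let psi := fl (mx2 a b b d) in
    [/\ (forall t, 0 < t < 1 -> fl_den (mx2 a b b d) t != 0),
        set_bij `]0, 1[ B° psi,
        (forall j t, third j t -> psi (F t) = F' (psi t)) &
        (forall j t, 0 < t < 1 -> psi (fl (X j) t) = fl (X j)^T (psi t))].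

(* B* shrinks to the point xi, which is then fixed by all the adjoints. *)
Definition singular_dual (X : 'I_3 -> 'M[R]_2) (xi : R) : Prop :=
  forall j, fl_den (X j)^T xi != 0 /\ fl (X j)^T xi = xi.

Definition has_natural_dual (X : 'I_3 -> 'M[R]_2) (F : R -> R) : Prop :=
  (exists (B : set R) (F' : R -> R), natural_dual X F B F') \/
  (exists xi : R, singular_dual X xi).

(* Ergodicity with respect to Lebesgue measure on [0, 1]. *)
Definition ergodic (F : R -> R) : Prop :=
  forall E : set (measurableTypeR R), measurable E -> E `<=` `[0, 1] ->
    `[0, 1] `&` F @^-1` E = E ->
    lebesgue_measure E = 0%E \/ lebesgue_measure (`[0, 1] `\` E) = 0%E.

(* Measures on [0, 1] are represented by the Borel measures on the line that
   are concentrated on [0, 1].  Absolute continuity is part of the notion: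
   invariant measures are given by densities. *)
Definition invariant_measure (F : R -> R)
    (m : {measure set (measurableTypeR R) -> \bar R}) : Prop :=
  [/\ m (~` `[0, 1]) = 0%E,
      m setT != 0%E,
      sigma_finite setT m,
      m `<< (@lebesgue_measure R) &
      forall E, measurable E -> m (`[0, 1] `&` F @^-1` E) = m E].

Definition ergodic_with_invariant_measure (F : R -> R) : Prop :=
  ergodic F /\ exists m, invariant_measure F m.

(* An invariant measure of an ergodic map is only determined up to a factor,
   hence the comparison of all the invariant measures. *)
Definition same_invariant_measure (F G : R -> R) : Prop :=
  (exists m, invariant_measure F m) /\
  (forall m, invariant_measure F m <-> invariant_measure G m).

End FractionalLinear.

(* Main.v *)
(* The condition that psi intertwines a branch and its adjoint is linear in the
   symmetric matrix P of psi; for T it has, up to a factor, one solution, and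
   the extra condition in each case says that the flipped branch satisfies it
   too.  Let q(x,y) = (1 x) P (1 y)^T.  If a branch X sends 0, 1 to u, v with
   denominators al, be, then den(x) q(X x,0) = al q(x,u) and
   den(x) q(X x,1) = be q(x,v), so the density h = 1/(q(x,0) q(x,1)) satisfies
   h(X x)|X'(x)| = |v-u|/(q(x,u) q(x,v)).  This only depends on the image of X,
   not on its orientation, and the sum over the three branches telescopes to h.
   Thus T and the flipped map preserve the same measure h dx.  Positivity of q
   means lam <= 3 and nu >= 1; otherwise T has an attracting fixed point at 0 or
   1, and a wandering interval near it contradicts ergodicity.

   The measure h dx is infinite when an endpoint is a neutral fixed point, so
   that the uniqueness of the invariant measure needs recurrence: almost every
   orbit returns infinitely often to some compact subset of ]0,1[.  If f is the
   density of an invariant measure with respect to h dx, then min(f,c) is the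
   density of a subinvariant measure, which is invariant by recurrence; hence
   {f < c} and {f > c} are almost forward invariant, and by ergodicity one of
   them is null.  As c is arbitrary, f is constant. *)
Require Import Defs.
From HB Require Import structures.
From mathcomp Require Import all_boot all_order all_algebra.
From mathcomp Require Import all_classical all_reals all_analysis.
From mathcomp Require Import measurable_realfun ring lra.
Import Order.TTheory GRing.Theory Num.Theory.
Import numFieldNormedType.Exports.
Set Implicit Arguments.
Unset Strict Implicit.
Unset Printing Implicit Defensive.
Local Open Scope classical_set_scope.
Local Open Scope ring_scope.

(** * Uniqueness of invariant measures *)

Section density.
Context d (T : measurableType d) (R : realType).
Variable mu : {measure set T -> \bar R}.
Local Open Scope ereal_scope.

(** The proofs [mf] and [f0] are arguments so that the measure structure declared below can be
    attached to the term. *)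
Definition density_measure (f : T -> \bar R) (mf : measurable_fun setT f)
  (f0 : forall x, 0 <= f x) : set T -> \bar R :=
  fun A => \int[mu]_(x in A) f x.

Section instance.
Variables (f : T -> \bar R) (mf : measurable_fun setT f)
  (f0 : forall x, 0 <= f x).
Local Notation nu := (density_measure mf f0).

Let nu0 : nu set0 = 0.
Proof. by rewrite /density_measure integral_set0. Qed.

Let nu_ge0 A : 0 <= nu A.
Proof. exact: integral_ge0. Qed.

Let nu_sigma_additive : semi_sigma_additive nu.
Proof.
move=> F mF tF mUF; rewrite /density_measure ge0_integral_bigcup//; last first.
  exact: measurable_funTS.
by apply: is_cvg_ereal_nneg_natsum => n _; exact: integral_ge0.
Qed.

HB.instance Definition _ := isMeasure.Build _ _ _ nu
  nu0 nu_ge0 nu_sigma_additive.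
End instance.

(** On a measurable part [E] of [M] the integral of [a] is at most that of [b], and likewise on the
    rest of [M]. As the totals are equal and finite, both inequalities are equalities, so [a] and
    [b] agree almost everywhere on [M]. *)
Lemma integral_eq_lt_null (a b : T -> \bar R) (M : set T) :
  measurable M -> measurable_fun setT a -> measurable_fun setT b ->
  (forall x, 0 <= a x) -> (forall x, M x -> a x <= b x) ->
  \int[mu]_(x in M) a x = \int[mu]_(x in M) b x ->
  \int[mu]_(x in M) a x < +oo ->
  mu (M `&` [set x | a x < b x]) = 0.
Proof.
move=> mM ma mb a0 ab eab aoo.
have b0 x : M x -> 0 <= b x by move=> Mx; exact: le_trans (a0 x) (ab x Mx).
have [N [mN N0 subN]] : ae_eq mu M a b.
  apply: integral_ae_eq => //.
  - apply/integrableP; split; first exact: measurable_funTS.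
    by under eq_integral do rewrite gee0_abs//.
  - exact: measurable_funTS.
  move=> E EM mE.
  have EU : M = E `|` (M `\` E) by rewrite setDUK.
  have mD : measurable (M `\` E) by exact: measurableD.
  have dis : [disjoint E & M `\` E] by apply/disj_set2P; rewrite setDIK.
  have aE : \int[mu]_(x in M) a x =
      \int[mu]_(x in E) a x + \int[mu]_(x in M `\` E) a x.
    by rewrite {1}EU ge0_integral_setU// -EU; exact: measurable_funTS.
  have bE : \int[mu]_(x in M) b x =
      \int[mu]_(x in E) b x + \int[mu]_(x in M `\` E) b x.
    by rewrite {1}EU ge0_integral_setU// -EU//; exact: measurable_funTS.
  have le1 : \int[mu]_(x in E) a x <= \int[mu]_(x in E) b x.
    apply: ge0_le_integral => //; try exact: measurable_funTS.
    by move=> x /EM; exact: ab.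
  have le2 : \int[mu]_(x in M `\` E) a x <= \int[mu]_(x in M `\` E) b x.
    apply: ge0_le_integral => //; try exact: measurable_funTS.
    by move=> x [Mx _]; exact: ab.
  have boo : \int[mu]_(x in M) b x < +oo by rewrite -eab.
  have ge0 (A : set T) : 0 <= \int[mu]_(x in A) a x by exact: integral_ge0.
  move: eab aoo boo; rewrite aE bE.
  have := ge0 E; have := ge0 (M `\` E); move: le1 le2.
  move: (integral mu E a) (integral mu E b) (integral mu (M `\` E) a)
    (integral mu (M `\` E) b) => [x| |] [y| |] [z| |] [t| |] //=.
  rewrite !lee_fin => xy zt _ _ [e] _ _; congr (_%:E); lra.
apply: (subset_measure0 _ mN _ N0).
  by apply: measurable_lte => //; exact: measurable_funTS.
move=> x [Mx abx]; apply: subN => /(_ Mx) e.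
by move: abx; rewrite /= e ltxx.
Qed.

End density.

Section sigma_finite_pack.
Context d (T : measurableType d) (R : realType).
Variable mu : {measure set T -> \bar R}.

(** A copy of [mu] indexed by the proof of its sigma-finiteness, because Radon-Nikodym is applied to
    a bundled sigma-finite measure. *)
Definition sigma_finite_pack (muF : sigma_finite setT mu) : set T -> \bar R := mu.

Variable muF : sigma_finite setT mu.
HB.instance Definition _ := Measure.on (sigma_finite_pack muF).
HB.instance Definition _ :=
  Measure_isSigmaFinite.Build _ _ _ (sigma_finite_pack muF) muF.
End sigma_finite_pack.

(** Radon-Nikodym is applied to the restrictions of [nu] to disjoint pieces of finite [nu]-measure,
    and the densities are summed. *)
Lemma sigma_finite_density d (T : measurableType d) (R : realType)
    (mu0 nu : {measure set T -> \bar R}) :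
  sigma_finite setT mu0 -> sigma_finite setT nu -> nu `<< mu0 ->
  exists f : T -> \bar R, [/\ measurable_fun setT f, (forall x, 0 <= f x)%E &
    forall A, measurable A -> nu A = (\int[mu0]_(x in A) f x)%E].
Proof.
move=> mu0F.
pose mu : {sigma_finite_measure set T -> \bar R} := sigma_finite_pack mu0F.
have -> : mu0 = mu by apply: eq_measure.
move=> [F UF /all_and2[mF Foo]] numu.
pose E := seqDU F.
have mE k : measurable (E k).
  by apply: measurableD => //; exact: bigsetU_measurable.
have Eoo k : (nu (E k) < +oo)%E.
  by rewrite (le_lt_trans _ (Foo k))// le_measure ?inE//; exact: subDsetl.
have dom k : mfrestr (mE k) (Eoo k) `<< mu.
  apply/null_content_dominatesP => A mA muA; rewrite /= /mfrestr /mrestr.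
  have /null_content_dominatesP/(_ A mA muA) nA := numu.
  by apply: (subset_measure0 _ mA _ nA) => //; exact: measurableI.
have [g /all_and4[g0 _ gi gE]] :=
  choice (fun k => radon_nikodym_sigma_finite (dom k)).
have mg k : measurable_fun setT (g k) by exact: measurable_int (gi k).
exists (fun x => \sum_(n <oo) g n x)%E; split.
- exact: ge0_emeasurable_sum.
- by move=> x; exact: nneseries_ge0.
move=> A mA; rewrite integral_nneseries//; last first.
  by move=> n; exact: measurable_funTS.
transitivity (nu (\bigcup_k (A `&` E k))).
  by rewrite -setI_bigcupr -seqDU_bigcup_eq -UF setIT.
rewrite measure_bigcup//; last 2 first.
- by move=> k _; exact: measurableI.
- exact/trivIset_setIl/trivIset_seqDU.
rewrite [LHS](@eq_eseriesl _ _ xpredT); last by move=> x; rewrite in_setT.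
by apply: eq_eseriesr => k _; rewrite -gE.
Qed.

(** * Invariant densities of an ergodic recurrent map *)

Section uniqueness.
Context d (T : measurableType d) (R : realType).
Local Open Scope ereal_scope.
Variables (mu : {measure set T -> \bar R}) (G : T -> T).
Hypothesis muF : sigma_finite setT mu.
Hypothesis mG : measurable_fun setT G.
Hypothesis mu_inv : forall E, measurable E -> mu (G @^-1` E) = mu E.

Lemma measurable_iter k : measurable_fun setT (iter k G).
Proof.
elim: k => [|k ih]; first exact: measurable_id.
by rewrite (_ : iter k.+1 G = G \o iter k G)//; exact: measurableT_comp.
Qed.

Lemma measurable_iter_preimage k E :
  measurable E -> measurable (iter k G @^-1` E).
Proof. by move=> mE; rewrite -[X in measurable X]setTI; exact: measurable_iter. Qed.

Lemma measurable_preimageG E : measurable E -> measurable (G @^-1` E).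
Proof. exact: (@measurable_iter_preimage 1). Qed.

Lemma iter_inv k E : measurable E -> mu (iter k G @^-1` E) = mu E.
Proof.
move=> mE; elim: k => [//|k ih].
rewrite -[RHS]ih -[RHS]mu_inv; last exact: measurable_iter_preimage.
by congr (mu _); apply/seteqP; split => x /=; rewrite -iterSr.
Qed.

Hypothesis G_ergodic : forall E, measurable E -> G @^-1` E = E ->
  mu E = 0 \/ mu (~` E) = 0.

(* the points which from some time on stay in [E] form a strictly invariant
   set, which contains almost all of [E] *)
Lemma ergodic_disjoint E E' : measurable E -> measurable E' ->
  E `&` E' = set0 ->
  mu (E `\` G @^-1` E) = 0 -> mu (E' `\` G @^-1` E') = 0 ->
  mu E = 0 \/ mu E' = 0.
Proof.
move=> mE mE' EE'.
pose ev (A : set T) := \bigcup_n \bigcap_(m >= n) (iter m G @^-1` A).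
have mev A : measurable A -> measurable (ev A).
  move=> mA; apply: bigcup_measurable => n _.
  by apply: bigcap_measurableType => m _; exact: measurable_iter_preimage.
have sub A : measurable A -> mu (A `\` G @^-1` A) = 0 -> mu (A `\` ev A) = 0.
  move=> mA A0.
  have mB k : measurable (iter k G @^-1` (A `\` G @^-1` A)).
    apply: measurable_iter_preimage; apply: measurableD => //.
    exact: measurable_preimageG.
  have /negligibleP -> // : mu.-negligible (A `\` ev A); last first.
    by apply: measurableD => //; exact: mev.
  (* An orbit that starts in [A] and leaves it has a last time [k] before the first exit; the [k]-th
     iterate then lies in the null set of points of [A] mapped outside [A]. *)
  apply: (@negligibleS _ _ _ _ (\bigcup_k (iter k G @^-1` (A `\` G @^-1` A)))).
    move=> x [Ax nev]; apply: contrapT => H; apply: nev.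
    exists 0%N => // m _ /=; elim: m => [//|m ih].
    by apply: contrapT => nA; apply: H; exists m.
  apply: negligible_bigcup => k; apply/negligibleP => //.
  apply: (eq_trans (iter_inv k _) A0).
  by apply: measurableD => //; exact: measurable_preimageG.
move=> E0 E'0.
have evinv : G @^-1` (ev E) = ev E.
  apply/seteqP; split => x [n _ H].
    exists n.+1 => // -[//|m] /= nm.
    by have := H m nm; rewrite /= -iterSr.
  by exists n => // m /= nm; rewrite -iterSr; apply: H => /=; exact: leqW.
have nev A : measurable A -> mu (A `\` G @^-1` A) = 0 ->
    mu.-negligible (A `\` ev A).
  move=> mA A0; apply/negligibleP; last exact: sub.
  by apply: measurableD => //; exact: mev.
have [e0|e0] := G_ergodic (mev _ mE) evinv; [left|right].
- suff : mu.-negligible E by move/negligibleP; apply.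
  apply: (@negligibleS _ _ _ _ ((E `\` ev E) `|` ev E)).
    by move=> x Ex; have [?|?] := pselect (ev E x); [right|left].
  apply: negligibleU; first exact: nev.
  by apply/negligibleP => //; exact: mev.
- suff : mu.-negligible E' by move/negligibleP; apply.
  apply: (@negligibleS _ _ _ _ ((E' `\` ev E') `|` ~` (ev E))).
    move=> x Ex; have [xe|?] := pselect (ev E' x); [right|by left].
    move=> [n _ Hn]; case: xe => n' _ Hn'.
    (* A point of both eventual sets would lie in [E] and in [E'] at a common late time. *)
    have : (E `&` E') (iter (maxn n n') G x).
      by split; [apply: Hn|apply: Hn']; rewrite /= ?leq_maxl ?leq_maxr.
    by rewrite EE'.
  apply: negligibleU; first exact: nev.
  by apply/negligibleP => //; apply: measurableC; exact: mev.
Qed.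

Variables (K : nat -> set T) (N : set T).
Hypotheses (mK : forall i, measurable (K i)) (Koo : forall i, mu (K i) < +oo).
Hypotheses (mN : measurable N) (N0 : mu N = 0).
Hypothesis recK : forall x, ~ N x ->
  exists i, forall n, exists2 k, (n <= k)%N & K i (iter k G x).

(* If [mu A = rho A + mu (G^-1 A)], then summing over the preimages of [K i]
   shows that almost every orbit, for [rho], visits [K i] finitely often, so
   that [rho = 0]. *)
Lemma recurrent_subinvariant (g : T -> \bar R) (c : R) :
  measurable_fun setT g -> (forall x, 0 <= g x) -> (forall x, g x <= c%:E) ->
  (forall E, measurable E ->
    \int[mu]_(x in G @^-1` E) g x <= \int[mu]_(x in E) g x) ->
  forall E, measurable E ->
    \int[mu]_(x in G @^-1` E) g x = \int[mu]_(x in E) g x.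
Proof.
move=> mg g0 gc sub.
pose nu := density_measure mu mg g0.
have c0 : (0 <= c)%R.
  by rewrite -lee_fin; exact: le_trans (g0 point) (gc point).
have nule A : measurable A -> nu A <= c%:E * mu A.
  move=> mA; rewrite -integral_cst//; apply: ge0_le_integral => //.
  exact: measurable_funTS.
have nuoo A : measurable A -> mu A < +oo -> nu A < +oo.
  move=> mA Aoo; apply: le_lt_trans (nule A mA) _.
  by rewrite lte_mul_pinfty// ?lee_fin.
have [F TF /all_and2[mF Foo]] := muF.
pose pnu_ : {measure set T -> \bar R} := pushforward nu G.
pose pnu := pnu_ mG.
have pnuE A : pnu A = \int[mu]_(x in G @^-1` A) g x by [].
(* By subinvariance [pnu] is dominated by [nu], hence by [c] times [mu]; so it is sigma-finite and
   has a density [k]. *)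
have [k [mk k0 kE]] : exists f : T -> \bar R,
    [/\ measurable_fun setT f, (forall x, 0 <= f x) &
    forall A, measurable A -> pnu A = \int[mu]_(x in A) f x].
  apply: sigma_finite_density => //.
    exists F => // i; split => //; rewrite pnuE.
    exact: le_lt_trans (sub _ (mF i)) (nuoo _ (mF i) (Foo i)).
  apply/null_content_dominatesP => A mA A0.
  apply/eqP; rewrite eq_le measure_ge0 andbT pnuE.
  by apply: le_trans (sub _ mA) _; apply: le_trans (nule _ mA) _; rewrite A0 mule0.
have gfin x : g x \is a fin_num.
  by rewrite ge0_fin_numE//; exact: le_lt_trans (gc x) (ltry _).
(* Subinvariance gives [k <= g] almost everywhere: on the finite pieces of [P] the integrals of [g]
   and [k] coincide although [g < k] there. *)
pose P := [set x | g x < k x].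
have mP : measurable P.
  by rewrite /P -[X in measurable X]setTI; exact: measurable_lte.
have P0 : mu.-negligible P.
  apply: (@negligibleS _ _ _ _ (\bigcup_i (P `&` F i))).
    by move=> x Px; have : setT x by []; rewrite TF => -[i _ Fx]; exists i.
  apply: negligible_bigcup => i; apply/negligibleP; first exact: measurableI.
  have mPF : measurable (P `&` F i) by exact: measurableI.
  have e : \int[mu]_(x in P `&` F i) g x = \int[mu]_(x in P `&` F i) k x.
    apply/eqP; rewrite eq_le; apply/andP; split.
      apply: ge0_le_integral => //; try exact: measurable_funTS.
      by move=> x [/ltW].
    by rewrite -kE// pnuE sub.
  have := integral_eq_lt_null mPF mg mk g0 (fun x H => ltW H.1) e.
  rewrite (_ : (P `&` F i) `&` [set x | g x < k x] = P `&` F i); last first.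
    by apply/seteqP; split => [x []//|x [? ?]].
  apply; apply: nuoo => //; apply: le_lt_trans (Foo i).
  by apply: le_measure; rewrite ?inE//; apply: subIsetr.
(* [e] is the density of the mass [rho] that [nu] loses under preimages; taking the positive part
   changes [g - k] on a null set only. *)
pose e x := maxe (g x - k x) 0.
have me : measurable_fun setT e.
  by apply: measurable_maxe => //; exact: emeasurable_funB.
have e0 x : 0 <= e x by rewrite /e le_max lexx orbT.
pose rho : {measure set T -> \bar R} := density_measure mu me e0.
have rhoE A : measurable A -> rho A + nu (G @^-1` A) = nu A.
  move=> mA; rewrite -[nu (_ @^-1` _)]/(pnu A) kE// /rho /= /density_measure.
  rewrite -ge0_integralD//; [|exact: measurable_funTS..].
  apply: ge0_ae_eq_integral => //.
  - by apply: emeasurable_funD; exact: measurable_funTS.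
  - exact: measurable_funTS.
  - by move=> x _; exact: adde_ge0.
  case: P0 => Q [mQ Q0 PQ]; exists Q; split => // x /= nH.
  apply: PQ; rewrite /P /=; apply: contrapT => /negP; rewrite -leNgt => kg.
  apply: nH => _; rewrite /e max_l; last by rewrite sube_ge0 ?gfin// orbT.
  rewrite subeK// ge0_fin_numE//; apply: le_lt_trans kg _.
  by rewrite -ge0_fin_numE.
(* Borel-Cantelli: by [rhoE] the values of [rho] on the successive preimages of [K i] have partial
   sums which telescope and stay below [nu (K i)]. *)
have rholim i : rho (lim_sup_set (fun n => iter n G @^-1` K i)) = 0.
  apply: lim_sup_set_cvg0; first by move=> n; exact: measurable_iter_preimage.
  apply: le_lt_trans (nuoo _ (mK i) (Koo i)).
  apply: lime_le; first exact: is_cvg_nneseries.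
  apply: nearW => n.
  suff <- : \sum_(0 <= j < n) rho (iter j G @^-1` K i) +
      nu (iter n G @^-1` K i) = nu (K i) by rewrite leeDl.
  elim: n => [|n ih]; first by rewrite big_nil add0e.
  rewrite big_nat_recr//= -addeA -[in RHS]ih; congr (_ + _).
  rewrite -[RHS]rhoE; last exact: measurable_iter_preimage.
  by congr (_ + nu _); apply/seteqP; split => x /=; rewrite -iterSr.
(* Outside [N] every orbit visits some [K i] infinitely often, so these null upper limits cover
   everything but [N]. *)
have rho0 : rho.-negligible setT.
  apply: (@negligibleS _ _ _ _
      (N `|` \bigcup_i lim_sup_set (fun n => iter n G @^-1` K i))).
    move=> x _; have [|/recK[i H]] := pselect (N x); first by left.
    by right; exists i => // n _; have [k' ? ?] := H n; exists k'.
  apply: negligibleU.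
    apply/negligibleP => //; rewrite /rho /= /density_measure.
    by apply: null_set_integral => //; exact: measurable_funTS.
  apply: negligible_bigcup => i; apply/negligibleP; last exact: rholim.
  apply: bigcap_measurable => // n _; apply: bigcup_measurable => j _.
  exact: measurable_iter_preimage.
move=> E mE; have := rhoE E mE.
have -> : rho E = 0 by apply/negligibleP => //; exact: negligibleS rho0.
by rewrite add0e.
Qed.

(** The minimum is subinvariant: where [f <= c] it is compared with the invariant density [f],
    elsewhere with the invariant constant [c]. Being bounded, it is invariant by
    [recurrent_subinvariant]. *)
Lemma recurrent_min (f : T -> \bar R) (c : R) : (0 <= c)%R ->
  measurable_fun setT f -> (forall x, 0 <= f x) ->
  (forall E, measurable E ->
    \int[mu]_(x in G @^-1` E) f x = \int[mu]_(x in E) f x) ->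
  forall E, measurable E ->
    \int[mu]_(x in G @^-1` E) (mine (f x) c%:E) =
    \int[mu]_(x in E) (mine (f x) c%:E).
Proof.
move=> c0 mf f0 finv.
have mm : measurable_fun setT (fun x => mine (f x) c%:E).
  exact: measurable_mine.
have m0 x : 0 <= mine (f x) c%:E by rewrite le_min f0 lee_fin.
apply: (@recurrent_subinvariant _ c) => //.
  by move=> x; rewrite ge_min lexx orbT.
move=> E mE.
pose E1 := E `&` [set x | f x <= c%:E]; pose E2 := E `\` [set x | f x <= c%:E].
have mle : measurable [set x | f x <= c%:E].
  by rewrite -[X in measurable X]setTI; exact: emeasurable_fun_infty_c.
have mE1 : measurable E1 by exact: measurableI.
have mE2 : measurable E2 by exact: measurableD.
have EE : E = E1 `|` E2 by rewrite /E1 /E2 setUIDK.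
have dis : [disjoint E1 & E2].
  by apply/disj_set2P; rewrite /E1 /E2 setDE setIACA setICr setI0.
rewrite [in leRHS]EE [in leLHS]EE preimage_setU.
rewrite !ge0_integral_setU//; try exact: measurable_funTS;
  try exact: measurable_preimageG; last first.
  by apply/disj_set2P; rewrite -preimage_setI (eqP dis) preimage_set0.
apply: leeD.
- apply: (@le_trans _ _ (\int[mu]_(x in G @^-1` E1) f x)).
    apply: ge0_le_integral => //; try exact: measurable_funTS.
    + exact: measurable_preimageG.
    + by move=> x _; rewrite ge_min lexx.
  rewrite finv//; apply: ge0_le_integral => //; try exact: measurable_funTS.
  by move=> x [_ /= fc]; rewrite min_l.
- apply: (@le_trans _ _ (\int[mu]_(x in G @^-1` E2) (cst c%:E x))).
    apply: ge0_le_integral => //; try exact: measurable_funTS.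
    + exact: measurable_preimageG.
    + by move=> x _; rewrite ge_min lexx orbT.
  rewrite integral_cst; last exact: measurable_preimageG.
  rewrite mu_inv// -integral_cst//.
  apply: ge0_le_integral => //; try exact: measurable_funTS.
  by move=> x [_ /= /negP]; rewrite -ltNge => /ltW cf; rewrite min_r.
Qed.

(** The minimum of [f] and [c] is invariant, as are [c] and [f]. Comparing it with [c] shows that
    almost every point of [{f < c}] stays there for one step; comparing it with [f] shows the same
    for [{c < f}]. Then [ergodic_disjoint] applies. *)
Lemma density_dichotomy (f : T -> \bar R) (c : R) : (0 <= c)%R ->
  measurable_fun setT f -> (forall x, 0 <= f x) ->
  (forall E, measurable E ->
    \int[mu]_(x in G @^-1` E) f x = \int[mu]_(x in E) f x) ->
  mu [set x | f x < c%:E] = 0 \/ mu [set x | c%:E < f x] = 0.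
Proof.
move=> c0 mf f0 finv.
have minv := recurrent_min c0 mf f0 finv.
pose a x := mine (f x) c%:E.
have ma : measurable_fun setT a by exact: measurable_mine.
have a0 x : 0 <= a x by rewrite le_min f0 lee_fin.
have [F TF /all_and2[mF Foo]] := muF.
have mlt : measurable [set x | f x < c%:E].
  by rewrite -[X in measurable X]setTI; exact: emeasurable_fun_infty_o.
have mgt : measurable [set x | c%:E < f x].
  by rewrite -[X in measurable X]setTI; exact: emeasurable_fun_o_infty.
have afin A : measurable A -> mu A < +oo -> \int[mu]_(x in A) a x < +oo.
  move=> mA Aoo; apply: (@le_lt_trans _ _ (\int[mu]_(x in A) (cst c%:E x))).
    apply: ge0_le_integral => //; try exact: measurable_funTS.
    by move=> x _; rewrite ge_min lexx orbT.
  by rewrite integral_cst// lte_mul_pinfty// lee_fin.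
have Foo' B i : measurable B -> mu (B `&` F i) < +oo.
  move=> mB; apply: le_lt_trans (Foo i).
  by apply: le_measure; rewrite ?inE//; exact: measurableI.
(* [E] is the set where [b] exceeds [a]. Invariance carries the equality of the integrals of [a] and
   [b] from pieces of the complement of [E] to their preimages. So [a = b] almost everywhere on
   these preimages, and almost no point of [E] enters the complement. *)
have null E (b : T -> \bar R) : measurable E -> measurable_fun setT b ->
    (forall x, a x <= b x) -> (forall x, ~ E x -> b x <= a x) ->
    (forall x, E x -> a x < b x) ->
    (forall A, measurable A ->
      \int[mu]_(x in G @^-1` A) b x = \int[mu]_(x in A) b x) ->
    mu (E `\` G @^-1` E) = 0.
  move=> mE mb ab ba altb binv.
  have mGE : measurable (G @^-1` E) by exact: measurable_preimageG.
  suff : mu.-negligible (E `\` G @^-1` E).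
    by move/negligibleP; apply; exact: measurableD.
  pose M i := G @^-1` (~` E `&` F i).
  have mEF i : measurable (~` E `&` F i).
    by apply: measurableI => //; exact: measurableC.
  have mM i : measurable (M i) by exact: measurable_preimageG.
  apply: (@negligibleS _ _ _ _ (\bigcup_i (M i `&` [set x | a x < b x]))).
    move=> x [Ex nE]; have : setT (G x) by []; rewrite TF => -[i _ Fx].
    by exists i => //; split => //; exact: altb.
  apply: negligible_bigcup => i; apply/negligibleP.
    apply: measurableI => //; rewrite -[X in measurable X]setTI.
    exact: measurable_lte.
  have e : \int[mu]_(x in ~` E `&` F i) a x = \int[mu]_(x in ~` E `&` F i) b x.
    apply: eq_integral => x; rewrite inE => -[nEx _].
    by apply/eqP; rewrite eq_le ab ba.
  apply: integral_eq_lt_null => //.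
    by rewrite /M minv// binv.
  by rewrite /M minv//; apply: afin => //; apply: Foo'; exact: measurableC.
apply: ergodic_disjoint => //.
- by apply/seteqP; split => // x [/= /lt_trans /[apply]]; rewrite ltxx.
- apply: (null _ (cst c%:E)) => //.
  + by move=> x; rewrite ge_min lexx orbT.
  + by move=> x /= /negP; rewrite -leNgt => cf; rewrite /a min_r.
  + by move=> x /= fc; rewrite /a min_l ?ltW.
  + move=> A mA; rewrite !integral_cst//; first by rewrite mu_inv.
    exact: measurable_preimageG.
- apply: (null _ f) => //.
  + by move=> x; rewrite ge_min lexx.
  + by move=> x /= /negP; rewrite -leNgt => fc; rewrite /a min_l.
  + by move=> x /= cf; rewrite /a min_r ?ltW.
Qed.

(** The factor is the supremum of the set [S] of the [c] with [f >= c] almost everywhere: by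
    [density_dichotomy], [f <= c] almost everywhere for any other [c >= 0]. If [S] is unbounded, [f]
    is infinite almost everywhere, against sigma-finiteness. *)
Lemma ergodic_invariant_unique (nu : {measure set T -> \bar R}) :
  sigma_finite setT nu -> nu `<< mu -> nu setT != 0 ->
  (forall E, measurable E -> nu (G @^-1` E) = nu E) ->
  exists2 c : R, (0 < c)%R & forall A, measurable A -> nu A = c%:E * mu A.
Proof.
move=> nuF numu nuT nuinv.
have [f [mf f0 fE]] := sigma_finite_density muF nuF numu.
have finv A : measurable A ->
    \int[mu]_(x in G @^-1` A) f x = \int[mu]_(x in A) f x.
  by move=> mA; rewrite -!fE ?nuinv//; exact: measurable_preimageG.
have mlt c : measurable [set x | f x < c].
  by rewrite -[X in measurable X]setTI; exact: emeasurable_fun_infty_o.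
have mgt c : measurable [set x | c < f x].
  by rewrite -[X in measurable X]setTI; exact: emeasurable_fun_o_infty.
pose S := [set c : R | (0 <= c)%R /\ mu.-negligible [set x | f x < c%:E]].
have S0 : S 0%R.
  split => //; rewrite (_ : [set _ | _] = set0); first exact: negligible_set0.
  by apply/seteqP; split => // x /=; rewrite ltNge f0.
have Sle c s : S s -> (c <= s)%R -> mu.-negligible [set x | f x < c%:E].
  move=> [_ +] cs; apply: negligibleS => x /= /lt_le_trans; apply.
  by rewrite lee_fin.
have nS c : (0 <= c)%R -> ~ S c -> mu.-negligible [set x | c%:E < f x].
  move=> c0 nSc; apply/negligibleP => //.
  have [H|//] := density_dichotomy c0 mf f0 finv.
  by exfalso; apply: nSc; split => //; apply/negligibleP.
have aeE c : 0 <= c -> mu.-negligible [set x | f x != c] ->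
    forall A, measurable A -> nu A = c * mu A.
  move=> c0 [Q [mQ Q0 QP]] A mA; rewrite fE// -integral_cst//.
  apply: ge0_ae_eq_integral => //; first exact: measurable_funTS.
  exists Q; split => // x /= H; apply: QP => /=; apply/eqP => fc.
  by apply: H => _.
have [[M SM]|unb] := pselect (exists M, ubound S M).
  have supS : has_sup S by split; [exists 0%R|exists M].
  have c0 : (0 <= sup S)%R by apply: ub_le_sup S0; exact: supS.2.
  have E A : measurable A -> nu A = (sup S)%:E * mu A.
    apply: aeE; first by rewrite lee_fin.
    apply: (@negligibleS _ _ _ _
      (\bigcup_n [set x | f x < (sup S - n.+1%:R^-1)%:E] `|`
       \bigcup_n [set x | (sup S + n.+1%:R^-1)%:E < f x])).
      move=> x /= /eqP; have := f0 x.
      case E : (f x) => [r| |] //= r0 rc; last by right; exists 0%N => //=; rewrite E ltry.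
      have : r != sup S by apply/eqP => rS; apply: rc; rewrite rS.
      rewrite neq_lt => /orP[|] /ltr_add_invr[k Hk].
        by left; exists k => //=; rewrite E lte_fin ltrBrDr.
      by right; exists k => //=; rewrite E lte_fin.
    apply: negligibleU; apply: negligible_bigcup => n.
      have : (sup S - n.+1%:R^-1 < sup S)%R.
        by rewrite ltrBlDr ltrDl invr_gt0.
      move=> /(sup_gt supS.1)[s Ss /ltW]; exact: Sle.
    apply: nS; first by rewrite addr_ge0// invr_ge0.
    move=> /(ub_le_sup supS.2).
    by rewrite leNgt ltrDl invr_gt0 ltr0n.
  exists (sup S) => //; rewrite lt_neqAle c0 andbT.
  by apply: contra_neq nuT => c00; rewrite E// -c00 mul0e.
have E A : measurable A -> nu A = +oo * mu A.
  apply: aeE => //.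
  apply: (@negligibleS _ _ _ _ (\bigcup_n [set x | f x < n%:R%:E])).
    move=> x /= /eqP; have := f0 x; case E : (f x) => [r| |] //= r0 _.
    exists (Num.truncn r).+1 => //=; rewrite E lte_fin.
    exact: truncnS_gt.
  apply: negligible_bigcup => n.
  have [s Ss ns] : exists2 s, S s & (n%:R <= s)%R.
    apply: contrapT => H; apply: unb; exists n%:R => s Ss.
    by rewrite leNgt; apply/negP => /ltW ?; apply: H; exists s.
  exact: Sle Ss ns.
(* Now a set of finite [nu]-measure is null for [mu], hence for [nu], and countably many such sets
   cover the space. *)
exfalso; move/eqP: nuT; apply.
have [F TF /all_and2[mF Foo]] := nuF.
suff : nu.-negligible setT by move/negligibleP; apply.
rewrite TF; apply: negligible_bigcup => i.
have Ei : nu (F i) = +oo * mu (F i) by exact: E.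
have := Foo i; have := measure_ge0 mu (F i).
rewrite le_eqVlt Ei => /predU1P[m0 _|m0]; last by rewrite gt0_mulye.
apply/negligibleP => //; apply: (eq_trans Ei).
by have := congr1 (fun t => +oo * t) m0; rewrite mule0 => <-.
Qed.

End uniqueness.

(** * Fractional linear branches *)

Section moebius.
Variable R : realType.

(* This matrix sends 0 and 1 to [u] and [v], where its denominator takes the
   values [al] and [be]. *)
Definition moebius (al be u v : R) : 'M[R]_2 :=
  mx2 al (be - al) (al * u) (be * v - al * u).

Lemma fl_den_mx2 (a b c d x : R) : fl_den (mx2 a b c d) x = a + b * x.
Proof. by rewrite /fl_den !mxE. Qed.

Lemma fl_mx2 (a b c d x : R) : fl (mx2 a b c d) x = (c + d * x) / (a + b * x).
Proof. by rewrite /fl fl_den_mx2 !mxE. Qed.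

Lemma tr_mx2 (a b c d : R) : (mx2 a b c d)^T = mx2 a c b d.
Proof.
by apply/matrixP => i j; rewrite !mxE; case: (i == 0); case: (j == 0).
Qed.

Lemma fl_moebius (al be u v x : R) : fl (moebius al be u v) x =
  (al * u * (1 - x) + be * v * x) / (al * (1 - x) + be * x).
Proof. by rewrite fl_mx2; congr (_ / _); ring. Qed.

Lemma fl_den_moebius (al be u v x : R) :
  fl_den (moebius al be u v) x = al * (1 - x) + be * x.
Proof. by rewrite fl_den_mx2; ring. Qed.

End moebius.

Section triple.
Variable R : realType.

Variables (al be u v : 'I_3 -> R).

Hypotheses (al0 : forall j, 0 < al j) (be0 : forall j, 0 < be j).

Hypothesis uv : forall j : 'I_3,
  (u j = j%:R / 3 /\ v j = j.+1%:R / 3) \/ (u j = j.+1%:R / 3 /\ v j = j%:R / 3).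

Variable X : 'I_3 -> 'M[R]_2.

Hypothesis XE : forall j, X j = moebius (al j) (be j) (u j) (v j).

Variable F : R -> R.

Hypothesis hF : unit_map X F.

Definition bden (j : 'I_3) (x : R) := al j * (1 - x) + be j * x.

Lemma ord_le3 (j : 'I_3) : 0 <= (j%:R : R) /\ (j%:R : R) + 1 <= 3.
Proof. by split; rewrite ?ler0n// -(natrD _ j 1) ler_nat addn1. Qed.

Lemma uvP j : [/\ 0 <= u j <= 1, 0 <= v j <= 1 & u j != v j].
Proof.
have [j0 j3] := ord_le3 j.
have e : (j.+1%:R : R) = j%:R + 1 by rewrite -natr1.
by case: (uv j) => -[-> ->]; rewrite e; (split; [lra|lra|]); apply/eqP; lra.
Qed.

Lemma bden_gt0 j x : 0 <= x <= 1 -> 0 < bden j x.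
Proof.
move=> x01; have := al0 j; have := be0 j; rewrite /bden => b a.
have [->|x0] := eqVneq x 0; first by nra.
have : 0 < x by rewrite lt_neqAle eq_sym x0; lra.
nra.
Qed.

Lemma flX j x : fl (X j) x =
  (al j * u j * (1 - x) + be j * v j * x) / bden j x.
Proof. by rewrite XE fl_moebius. Qed.

Lemma bden_flX j x : bden j x != 0 ->
  bden j x * fl (X j) x = al j * u j * (1 - x) + be j * v j * x.
Proof. by move=> d0; rewrite flX mulrC divfK. Qed.

Lemma in_third (j : 'I_3) (x : R) :
  third j x <-> j%:R / 3 < x < j.+1%:R / 3.
Proof. by rewrite /third /= in_itv. Qed.

Lemma third01 j (x : R) : third j x -> 0 < x < 1.
Proof.
move=> /in_third; have [j0 j3] := ord_le3 j; rewrite -[j.+1%:R]natr1; lra.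
Qed.

Lemma F_third j x : third j x -> 0 < F x < 1 /\ fl (X j) (F x) = x.
Proof.
have [_ /(_ j)[[Ff _ _] _ XF]] := hF; rewrite interior_itv in Ff.
by move=> jx; split; [have /= := Ff x jx; rewrite in_itv|exact: XF].
Qed.

Lemma F_flX j y : 0 < y < 1 -> third j (fl (X j) y) /\ F (fl (X j) y) = y.
Proof.
have [_ /(_ j)[[_ _ Fs] _ XF]] := hF; rewrite interior_itv in Fs.
move=> y01; have [|x jx <-] := Fs y; first by rewrite /= in_itv.
by rewrite XF.
Qed.

Lemma F01 x : 0 <= x <= 1 -> 0 <= F x <= 1.
Proof.
by have [Ff _] := hF; move=> x01; have := Ff x; rewrite /= !in_itv; apply.
Qed.

Local Notation L := (@lebesgue_measure R).

(* [F] need not be measurable outside of [0,1]. *)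
Definition Fext (x : R) : R := if 0 <= x <= 1 then F x else 0.

Lemma Fext01 x : 0 <= Fext x <= 1.
Proof. by rewrite /Fext; case: ifPn => [/F01//|_]; lra. Qed.

Lemma Fext_third j x : third j x -> Fext x = F x.
Proof. by move=> /third01 x01; rewrite /Fext ifT//; lra. Qed.

(** This solves [x = fl (X j) (F x)] for [F x]. On the third both terms of the denominator have the
    sign of [v j - u j]. *)
Lemma third_inv j x : third j x ->
  al j * (x - u j) + be j * (v j - x) != 0 /\
  F x = al j * (x - u j) / (al j * (x - u j) + be j * (v j - x)).
Proof.
move=> jx; have [F01x XF] := F_third jx.
have d0 : 0 < bden j (F x) by apply: bden_gt0; lra.
have e := bden_flX (lt0r_neq0 d0); rewrite XF /bden in e.
have ne : al j * (x - u j) + be j * (v j - x) != 0.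
  have a := al0 j; have b := be0 j; move/in_third: jx => jx.
  case: (uv j) => -[-> ->].
    rewrite gt_eqF// addr_gt0// mulr_gt0//; lra.
  rewrite lt_eqF// -oppr_gt0 opprD -!mulrN addr_gt0// mulr_gt0//; lra.
by split => //; apply: (canRL (mulfK ne)); lra.
Qed.

Lemma third_trichotomy (x : R) : 0 < x < 1 -> x != 1/3 -> x != 2/3 ->
  exists j, third j x.
Proof.
move=> x01; rewrite !neq_lt => /orP[n1|n1] /orP[n2|n2].
- by exists ord0; apply/in_third => /=; lra.
- by exists ord0; apply/in_third => /=; lra.
- by exists (inord 1); apply/in_third; rewrite inordK//; lra.
- by exists (inord 2); apply/in_third; rewrite inordK//; lra.
Qed.

Definition offbranch : set R := ~` \bigcup_j third j.

Lemma measurable_third j : measurable (third j : set R).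
Proof. exact: measurable_itv. Qed.

Lemma measurable_thirds : measurable (\bigcup_j third j : set R).
Proof. by apply: fin_bigcup_measurable => // j _; exact: measurable_third. Qed.

Lemma measurable_offbranch : measurable offbranch.
Proof. by apply: measurableC; exact: measurable_thirds. Qed.

Lemma measurable_Fext : measurable_fun setT Fext.
Proof.
have m3 j : measurable_fun (third j : set R) Fext.
  apply: (@eq_measurable_fun _ _ _ _ (third j : set R)
    (fun x : R => al j * (x - u j) / (al j * (x - u j) + be j * (v j - x)) : R)).
    by move=> x /set_mem jx; rewrite (Fext_third jx) (third_inv jx).2.
  apply: open_continuous_measurable_fun; first exact: interval_open.
  move=> x /set_mem jx; have [ne _] := third_inv jx.
  apply: cvgM; last apply: (cvgV ne).
    by apply: cvgMr; apply: cvgB; [exact: cvg_id|exact: cvg_cst].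
  apply: cvgD; apply: cvgMr; apply: cvgB;
    by [exact: cvg_id|exact: cvg_cst].
(* [F] is arbitrary at the four partition points, so each of them is a measurable piece of its
   own. *)
pose S : set R := ~` `[0, 1] `|`
  ([set 0] `|` ([set (1/3)] `|` ([set (2/3)] `|` [set 1]))).
have mS4 : measurable ([set 0] `|` ([set (1/3)] `|` ([set (2/3)] `|` [set 1])) : set R).
  by do !apply: measurableU => //.
have mC : measurable (~` `[0, 1] : set R) by apply: measurableC.
have mS : measurable S by exact: measurableU.
have mT j : measurable (third j : set R) by exact: measurable_third.
have -> : [set: R] = S `|` (third ord0 `|` (third (inord 1) `|` third (inord 2))).
  apply/seteqP; split => // x _.
  have [x01|nx] := pselect (0 < x < 1); last first.
    left; have [x01|?] := pselect (`[0, 1]%classic x); last by left.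
    right; move: x01; rewrite /= in_itv /= => /andP[x0 x1].
    have [->|n0] := eqVneq x 0; first by left.
    have [->|n1] := eqVneq x 1; first by right; right; right.
    by exfalso; apply: nx; rewrite !lt_neqAle x0 x1 n1 eq_sym n0.
  have [->|n1] := eqVneq x (1/3); first by left; right; right; left.
  have [->|n2] := eqVneq x (2/3); first by left; right; right; right; left.
  right; move: n1 n2; rewrite !neq_lt => /orP[n1|n1] /orP[n2|n2].
  - by left; apply/in_third => /=; lra.
  - by left; apply/in_third => /=; lra.
  - by right; left; apply/in_third; rewrite inordK//; lra.
  - by right; right; apply/in_third; rewrite inordK//; lra.
have m12 := measurableU _ _ (mT (inord 1)) (mT (inord 2)).
have m012 := measurableU _ _ (mT ord0) m12.
apply/measurable_funU => //; split; last first.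
  by apply/measurable_funU => //; split => //; apply/measurable_funU.
apply/measurable_funU => //; split.
  apply: (@eq_measurable_fun _ _ _ _ (~` `[0, 1] : set R) (cst 0 : R -> R)) => [x|]; last exact: measurable_cst.
  by rewrite inE /= in_itv /= => /negP nx; rewrite /Fext (negPf nx).
apply/measurable_funU => //; first by do !apply: measurableU => //.
split; first exact: measurable_fun_set1.
apply/measurable_funU => //; first by do !apply: measurableU => //.
split; first exact: measurable_fun_set1.
by apply/measurable_funU => //; split; exact: measurable_fun_set1.
Qed.

(** * Monotonicity and derivatives of the branches *)

Lemma is_derive_affine (c k x : R) : is_derive x 1 (fun y : R => c + k * y) k.
Proof.
have := is_deriveD (is_derive_cst c x 1) (is_deriveZ k (is_derive_id x 1)).
by rewrite add0r [_ *: _]mulr1; exact.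
Qed.

(** The constant [al j * be j * (v j - u j)] is the determinant of [X j]; its sign decides whether
    the branch increases on [[0, 1]]. *)
Lemma flX_sub j x y : bden j x != 0 -> bden j y != 0 ->
  fl (X j) y - fl (X j) x =
  al j * be j * (v j - u j) * (y - x) / (bden j x * bden j y).
Proof.
move=> dx dy; rewrite !flX; move: dx dy; rewrite /bden => dx dy.
by field; rewrite dx dy.
Qed.

Lemma is_derive_flX j x : bden j x != 0 ->
  is_derive x 1 (fl (X j)) (al j * be j * (v j - u j) / bden j x ^+ 2).
Proof.
move=> dx.
have -> : fl (X j) = (fun x => al j * u j * (1 - x) + be j * v j * x) *
    (fun x => (bden j x)^-1).
  by apply/funext => y; rewrite flX.
have d1 : is_derive x 1 (fun x : R => al j * u j * (1 - x) + be j * v j * x)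
    (be j * v j - al j * u j).
  have -> : (fun x : R => al j * u j * (1 - x) + be j * v j * x) =
      (fun x => al j * u j + (be j * v j - al j * u j) * x).
    by apply/funext => y; ring.
  exact: is_derive_affine.
have d2 : is_derive x 1 (bden j) (be j - al j).
  have -> : bden j = (fun x => al j + (be j - al j) * x).
    by apply/funext => y; rewrite /bden; ring.
  exact: is_derive_affine.
have d3 := is_deriveV dx d2.
apply: (is_derive_eq (is_deriveM d1 d3)).
by rewrite /GRing.scale /= /bden; move: dx; rewrite /bden => dx; field.
Qed.

Lemma continuous_bden j x : {for x, continuous (bden j)}.
Proof.
by apply: cvgD; apply: cvgMr => //; apply: cvgB => //; exact: cvg_cst.
Qed.

Lemma near_bden j x : bden j x != 0 -> \forall y \near x, bden j y != 0.
Proof.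
move=> dx; have : open [set y : R | y != 0] by exact: open_neq.
move=> /(_ (bden j x) dx) H; exact: (continuous_bden H).
Qed.

Lemma continuous_derive_flX j x : bden j x != 0 ->
  {for x, continuous ((derive1 (fl (X j))))}.
Proof.
move=> dx.
have E y : bden j y != 0 ->
    (derive1 (fl (X j))) y = al j * be j * (v j - u j) / bden j y ^+ 2.
  by move=> dy; rewrite derive1E; have [] := is_derive_flX dy.
rewrite /prop_for /continuous_at E//.
pose D y := al j * be j * (v j - u j) / bden j y ^+ 2.
suff cD : D y @[y --> x] --> D x.
  have H : {near x, D =1 derive1 (fl (X j))}.
    by near=> y; rewrite /D E//; near: y; exact: near_bden.
  exact: cvg_trans (near_eq_cvg H) cD.
apply: cvgMr; apply: cvgV; first by rewrite expf_neq0.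
by apply: cvgM; exact: continuous_bden.
Unshelve. all: by end_near. Qed.

Lemma continuous_flX j x : bden j x != 0 -> {for x, continuous (fl (X j))}.
Proof.
move=> dx; apply: differentiable_continuous; apply/derivable1_diffP.
by have [] := is_derive_flX dx.
Qed.

(** By [flX_sub] the branch is strictly monotone; a decreasing branch moves the closed end of the
    interval to the other side. *)
Lemma preimage_branch j (a b : R) : 0 < a -> a < b -> b < 1 ->
  third j `&` (Fext @^-1` `]a, b]%classic) =
  (if u j < v j then `](fl (X j) a), (fl (X j) b)]%classic
   else `[(fl (X j) b), (fl (X j) a)[%classic) :> set R.
Proof.
move=> a0 ab b1.
have a01 : 0 < a < 1 by lra.
have b01 : 0 < b < 1 by lra.
have [Xa _] := F_flX j a01; have [Xb _] := F_flX j b01.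
have sg x y : 0 < x < 1 -> 0 < y < 1 -> exists2 c, 0 < c &
    fl (X j) y - fl (X j) x = c * (v j - u j) * (y - x).
  move=> x01 y01.
  have dx : 0 < bden j x by apply: bden_gt0; lra.
  have dy : 0 < bden j y by apply: bden_gt0; lra.
  exists (al j * be j / (bden j x * bden j y)).
    by rewrite divr_gt0 ?mulr_gt0.
  by rewrite flX_sub ?gt_eqF//; field; rewrite !gt_eqF.
have third_conv (x y z : R) : third j x -> third j y -> x <= z <= y -> third j z.
  by move=> /in_third ? /in_third ? ?; apply/in_third; lra.
have mono (x : R) : third j x -> exists c d, [/\ 0 < c, 0 < d,
   x - fl (X j) a = c * (v j - u j) * (F x - a) &
   fl (X j) b - x = d * (v j - u j) * (b - F x)].
  move=> jx; have [Fx XF] := F_third jx.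
  have [c c0 ec] := sg _ _ a01 Fx; have [d d0 ed] := sg _ _ Fx b01.
  by exists c, d; split => //; rewrite -?ec -?ed XF.
case: ifPn => [uv'|].
  apply/seteqP; split => x.
    move=> [jx /=]; rewrite in_itv /= (Fext_third jx) => Fx; rewrite in_itv /=.
    have [c [d [c0 d0 ec ed]]] := mono _ jx.
    have := mulr_gt0 c0 (_ : 0 < v j - u j).
    have := mulr_gt0 d0 (_ : 0 < v j - u j).
    rewrite subr_gt0 => /(_ uv') k1 /(_ uv') k2; apply/andP; split.
      by rewrite -subr_gt0 ec mulr_gt0//; lra.
    by rewrite -subr_ge0 ed mulr_ge0//; lra.
  rewrite /= in_itv /= => xab.
  have jx : third j x by apply: third_conv Xa Xb _; lra.
  split => //; rewrite /= in_itv /= (Fext_third jx).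
  have [c [d [c0 d0 ec ed]]] := mono _ jx.
  have := mulr_gt0 c0 (_ : 0 < v j - u j).
  have := mulr_gt0 d0 (_ : 0 < v j - u j).
  rewrite subr_gt0 => /(_ uv') k1 /(_ uv') k2; apply/andP; split.
    by rewrite -subr_gt0 -(pmulr_rgt0 _ k2) -ec; lra.
  by rewrite -subr_ge0 -(pmulr_rge0 _ k1) -ed; lra.
rewrite -leNgt le_eqVlt => /orP[/eqP e|vu].
  by have [_ _] := uvP j; rewrite e eqxx.
apply/seteqP; split => x.
  move=> [jx /=]; rewrite in_itv /= (Fext_third jx) => Fx; rewrite in_itv /=.
  have [c [d [c0 d0 ec ed]]] := mono _ jx.
  have := mulr_gt0 c0 (_ : 0 < u j - v j).
  have := mulr_gt0 d0 (_ : 0 < u j - v j).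
  rewrite subr_gt0 => /(_ vu) k1 /(_ vu) k2; apply/andP; split.
    have : 0 <= d * (u j - v j) * (b - F x) by rewrite mulr_ge0//; lra.
    by move: ed; lra.
  have : 0 < c * (u j - v j) * (F x - a) by rewrite mulr_gt0//; lra.
  by move: ec; lra.
rewrite /= in_itv /= => xab.
have jx : third j x by apply: third_conv Xb Xa _; lra.
split => //; rewrite /= in_itv /= (Fext_third jx).
have [c [d [c0 d0 ec ed]]] := mono _ jx.
have := mulr_gt0 c0 (_ : 0 < u j - v j).
have := mulr_gt0 d0 (_ : 0 < u j - v j).
rewrite subr_gt0 => /(_ vu) k1 /(_ vu) k2; apply/andP; split.
  by rewrite -subr_gt0 -(pmulr_rgt0 _ k2); move: ec; lra.
by rewrite -subr_ge0 -(pmulr_rge0 _ k1); move: ed; lra.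
Qed.

Lemma measurable_Fext_preimage (E : set (measurableTypeR R)) :
  measurable E -> measurable (Fext @^-1` E : set (measurableTypeR R)).
Proof.
by move=> mE; rewrite -[X in measurable X]setTI; exact: measurable_Fext.
Qed.

(** * Exhaustion of the open unit interval *)

(** The intervals are half-open, so that their intersections with the half-open intervals generating
    the Borel sets are again of this form. The first one is empty. *)
Definition cpt (n : nat) : set (measurableTypeR R) :=
  `]n.+2%:R^-1, (1 - n.+2%:R^-1)]%classic.

Lemma cptP n (x : R) : cpt n x <-> n.+2%:R^-1 < x <= 1 - n.+2%:R^-1.
Proof. by rewrite /cpt /= in_itv. Qed.

Lemma inv_n2 n : 0 < (n.+2%:R^-1 : R) /\ (n.+2%:R^-1 : R) <= 1 / 2.
Proof.
split; first by rewrite invr_gt0.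
by rewrite div1r lef_pV2 ?posrE// ler_nat.
Qed.

Lemma small_inv_n2 (x : R) : 0 < x -> exists n : nat, n.+2%:R^-1 < x.
Proof.
move=> /ltr_add_invr[k]; rewrite add0r => kx; exists k.
by apply: le_lt_trans kx; rewrite lef_pV2 ?posrE// ler_nat.
Qed.

Lemma measurable_cpt n : measurable (cpt n).
Proof. exact: measurable_itv. Qed.

Lemma cpt_mono : {homo cpt : n m / (n <= m)%N >-> (n <= m)%O}.
Proof.
move=> n m nm; apply/subsetPset => x /cptP nx; apply/cptP.
have : (m.+2%:R^-1 : R) <= n.+2%:R^-1 by rewrite lef_pV2 ?posrE// ler_nat.
move: (n.+2%:R^-1) (m.+2%:R^-1) nx => a b; lra.
Qed.

Lemma cpt_cover (x : R) : 0 < x < 1 -> exists n, cpt n x.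
Proof.
move=> x01.
have [i xi] : exists i : nat, i.+2%:R^-1 < x by apply: small_inv_n2; lra.
have [j xj] : exists j : nat, j.+2%:R^-1 < 1 - x by apply: small_inv_n2; lra.
exists (maxn i j); apply/cptP.
have : ((maxn i j).+2%:R^-1 : R) <= i.+2%:R^-1.
  by rewrite lef_pV2 ?posrE// ler_nat !ltnS leq_maxl.
have : ((maxn i j).+2%:R^-1 : R) <= j.+2%:R^-1.
  by rewrite lef_pV2 ?posrE// ler_nat !ltnS leq_maxr.
move: (_.+2%:R^-1) (i.+2%:R^-1) (j.+2%:R^-1) xi xj => a b c; lra.
Qed.

Lemma bigcup_cpt : \bigcup_n cpt n = (`]0, 1[%classic : set (measurableTypeR R)).
Proof.
apply/seteqP; split => x; rewrite /= in_itv /=.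
  move=> [n _ /cptP nx]; have [] := inv_n2 n.
  by move: (n.+2%:R^-1) nx => a; lra.
by move=> /cpt_cover[n nx]; exists n.
Qed.

Lemma measurable_out : measurable (~` `]0, 1[ : set (measurableTypeR R)).
Proof. by apply: measurableC; exact: measurable_itv. Qed.

(** Continuity from below, after removal of a null set. It extends an equality of two measures from
    all the [cpt n] to the line. *)
Lemma cpt_cvg (m : {measure set (measurableTypeR R) -> \bar R}) E :
  measurable E -> m (~` `]0, 1[) = 0%E ->
  m (E `&` cpt n) @[n --> \oo] --> m E.
Proof.
move=> mE mout.
have mEK n : measurable (E `&` cpt n).
  by apply: measurableI => //; exact: measurable_cpt.
have mE1 : measurable (E `&` `]0, 1[) by apply: measurableI.
have mE2 : measurable (E `&` ~` `]0, 1[).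
  by apply: measurableI => //; exact: measurable_out.
have -> : m E = m (\bigcup_n (E `&` cpt n)).
  rewrite -setI_bigcupr bigcup_cpt -{1}(setUIDK E `]0, 1[) setDE.
  rewrite (measureU0 mE1 mE2)//.
  exact: (subset_measure0 mE2 measurable_out (@subIsetr _ _ _) mout).
apply: nondecreasing_cvg_mu => //.
  exact: bigcup_measurable.
by move=> n k nk; apply/subsetPset; apply: setIS; apply/subsetPset/cpt_mono.
Qed.

Lemma preimage_out : Fext @^-1` (~` `]0, 1[) `<=` offbranch.
Proof.
move=> x /= nx [j _ jx]; apply: nx.
by rewrite (Fext_third jx) /= in_itv; exact: (F_third jx).1.
Qed.

Lemma preimage_F (E : set (measurableTypeR R)) :
  `[0, 1] `&` F @^-1` E = `[0, 1] `&` Fext @^-1` E.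
Proof.
by apply/seteqP; split => x [/= x01]; rewrite /Fext; move: x01;
  rewrite in_itv /= => x01; rewrite x01; split.
Qed.

Let I01 : set (measurableTypeR R) := `[0, 1]%classic.

Let mI01 : measurable I01. Proof. exact: measurable_itv. Qed.

Let mI01C : measurable (~` I01). Proof. exact: measurableC. Qed.

Lemma preimage_inv (m : {measure set (measurableTypeR R) -> \bar R}) :
  m (~` `[0, 1]) = 0%E -> forall E, measurable E ->
  m (`[0, 1] `&` F @^-1` E) = m (Fext @^-1` E).
Proof.
move=> mout E mE; rewrite preimage_F.
have mG := measurable_Fext_preimage mE.
have m1 : measurable (I01 `&` Fext @^-1` E) by exact: measurableI.
have m2 : measurable (~` I01 `&` Fext @^-1` E) by exact: measurableI.
rewrite -[in RHS](setIidr (@subsetT _ (Fext @^-1` E))) -(setUv I01) setIUl.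
rewrite (measureU0 m1 m2)//.
exact: (subset_measure0 m2 mI01C (@subIsetl _ _ _) mout).
Qed.

(** * Attracting fixed points *)

Section attracting.
Variables (j : 'I_3) (l m : R).
Hypotheses (uvj : u j < v j) (lm : l < m).
Hypothesis I_third : forall x : R, l < x < m -> third j x.
Hypothesis FI : forall x : R, l < x < m -> l < F x < m.

Let FextI x : l < x < m -> Fext x = F x.
Proof. by move=> /I_third; exact: Fext_third. Qed.

Let F_mono (x y : R) : third j x -> third j y -> x < y -> F x < F y.
Proof.
move=> jx jy; have [Fx ex] := F_third jx; have [Fy ey] := F_third jy.
have dx : 0 < bden j (F x) by apply: bden_gt0; lra.
have dy : 0 < bden j (F y) by apply: bden_gt0; lra.
have := flX_sub (lt0r_neq0 dx) (lt0r_neq0 dy); rewrite ex ey => e.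
have {}e : y - x =
    al j * be j * (v j - u j) / (bden j (F x) * bden j (F y)) * (F y - F x).
  by rewrite e mulrAC.
have c0 : 0 < al j * be j * (v j - u j) / (bden j (F x) * bden j (F y)).
  by rewrite divr_gt0 ?mulr_gt0 ?subr_gt0.
by rewrite -subr_gt0 e (pmulr_rgt0 _ c0) subr_gt0.
Qed.

Let iterI n x : l < x < m -> l < iter n Fext x < m.
Proof. by move=> xI; elim: n => //= n ih; rewrite FextI ?FI. Qed.

Let iter_mono n x y : l < x < m -> l < y < m -> x < y -> iter n Fext x < iter n Fext y.
Proof.
move=> xI yI xy; elim: n => //= n ih.
by rewrite !FextI ?iterI//; apply: F_mono => //; apply: I_third; exact: iterI.
Qed.

Let iter_inj n x y : l < x < m -> l < y < m -> iter n Fext x = iter n Fext y -> x = y.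
Proof.
move=> xI yI e; apply/eqP; case: ltgtP => // xy; exfalso.
  by have := iter_mono n xI yI xy; rewrite e ltxx.
by have := iter_mono n yI xI xy; rewrite e ltxx.
Qed.

Let iter_surj n a b z : l < a < m -> l < b < m ->
  iter n Fext a < z < iter n Fext b -> exists2 y, a < y < b & iter n Fext y = z.
Proof.
move=> aI bI; elim: n z => [|n ih] z /=; first by move=> abz; exists z.
have aI' := iterI n aI; have bI' := iterI n bI.
rewrite !FextI// => zab.
have z01 : 0 < z < 1.
  have := (F_third (I_third aI')).1; have := (F_third (I_third bI')).1; lra.
have [jX FX] := F_flX j z01.
have wab : iter n Fext a < fl (X j) z < iter n Fext b.
  apply/andP; split; rewrite ltNge le_eqVlt; apply/negP => /predU1P[e|h].
  - by move: zab; rewrite -FX e ltxx.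
  - by have := F_mono jX (I_third aI') h; rewrite FX; lra.
  - by move: zab; rewrite -FX -e ltxx andbF.
  - by have := F_mono (I_third bI') jX h; rewrite FX; lra.
have [y yab ey] := ih _ wab.
by exists y => //; rewrite ey (Fext_third jX) FX.
Qed.

(* the grand orbits of the two halves of a wandering interval are disjoint *)
Lemma wandering_not_ergodic (c d : R) : l < c -> c < d -> d < m ->
  (forall x k, c < x < d -> ~ (c < iter k.+1 Fext x < d)) -> ~ ergodic F.
Proof.
move=> lc cd dm wander eF.
pose e := (c + d) / 2.
have ce : c < e by rewrite /e; lra.
have ed : e < d by rewrite /e; lra.
have cI : l < c < m by lra.
have eI : l < e < m by lra.
(* [E] is the grand orbit of []c, e[]. As the iterates increase on []l, m[], the [k]-th image of
   []c, e[] is the interval between the images of its ends. *)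
pose O n k : set (measurableTypeR R) :=
  iter n Fext @^-1` `](iter k Fext c), (iter k Fext e)[%classic.
pose E : set (measurableTypeR R) := `[0, 1]%classic `&` \bigcup_n \bigcup_k O n k.
have I01x (x : R) : l < x < m -> 0 <= x <= 1.
  by move=> /I_third/third01; lra.
have mE : measurable E.
  apply: measurableI; first exact: measurable_itv.
  apply: bigcup_measurable => n _; apply: bigcup_measurable => k _.
  have mFext : measurable_fun setT (Fext : measurableTypeR R -> measurableTypeR R).
    exact: measurable_Fext.
  by apply: (measurable_iter_preimage mFext); exact: measurable_itv.
have EP (x : R) : E x <-> 0 <= x <= 1 /\
    exists n k, iter k Fext c < iter n Fext x < iter k Fext e.
  split; rewrite /E /= in_itv /=.
    by move=> [x01 [n _ [k _]]]; rewrite /O /= in_itv /= => H; split => //; exists n, k.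
  by move=> [x01 [n [k H]]]; split => //; exists n => //; exists k => //; rewrite /O /= in_itv.
have big (a b : R) (A : set (measurableTypeR R)) : measurable A -> a < b ->
    (`]a, b[%classic : set (measurableTypeR R)) `<=` A ->
    lebesgue_measure A <> 0%E.
  move=> mA ab sub A0.
  have : lebesgue_measure (`]a, b[%classic : set (measurableTypeR R)) = 0%E.
    by apply: subset_measure0 sub A0 => //; exact: measurable_itv.
  by rewrite lebesgue_measure_itv /= lte_fin ab -EFinB => -[]; lra.
have [] := eF E mE.
- by move=> x [].
- rewrite preimage_F; apply/seteqP; split => x.
    move=> [/=]; rewrite in_itv /= => x01 /EP[_ [n [k H]]]; apply/EP; split => //.
    by exists n.+1, k; rewrite iterSr.
  move=> /EP[x01 [n [k H]]]; split; first by rewrite /= in_itv.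
  apply/EP; split; first exact: Fext01.
  have ck := iterI k cI; have ek := iterI k eI.
  have xI : l < iter n Fext x < m by lra.
  exists n, k.+1; rewrite -iterSr /= !FextI//.
  by apply/andP; split; apply: F_mono; (try exact: I_third); lra.
- apply: (big c e) => // x; rewrite /= in_itv /= => xce; apply/EP.
  by split; [apply: I01x; lra|exists 0%N, 0%N].
apply: (big e d) => //.
  by apply: measurableD => //; exact: measurable_itv.
move=> x; rewrite /= in_itv /= => xed.
have xI : l < x < m by lra.
split; first by rewrite /= in_itv; exact: I01x.
move=> /EP[_ [n [k H]]].
(* Some [y] in []c, e[] has [k]-th iterate equal to the [n]-th iterate of [x]. Cancelling the common
   iterations by injectivity gives [x = y] or a return to []c, d[], both impossible. *)
have [y yce ey] := iter_surj cI eI H.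
have yI : l < y < m by lra.
have [nk|kn] := leqP n k.
  move: ey; rewrite -(subnKC nk) iterD => /(iter_inj (iterI _ yI) xI) exy.
  case: (k - n)%N exy => [/= exy|i exy]; first by lra.
  by apply: (wander y i); [lra|rewrite exy; lra].
move: ey; rewrite -(subnKC (ltnW kn)) iterD => /(iter_inj yI (iterI _ xI)) exy.
move: exy; rewrite -[(n - k)%N]prednK ?subn_gt0// => exy.
by apply: (wander x (n - k).-1); [lra|rewrite -exy; lra].
Qed.

(** When [F] moves all points of []l, m[] the same way, the interval between [c] and [F c] is
    wandering: after one step its points lie beyond [F c], and they keep moving away. *)
Lemma attracting_not_ergodic :
  (forall x, l < x < m -> F x < x) \/ (forall x, l < x < m -> x < F x) ->
  ~ ergodic F.
Proof.
pose c := (l + m) / 2.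
have cI : l < c < m by have := lm; rewrite /c => ?; apply/andP; split; lra.
have FcI := FI cI.
case=> H; have Hc := H c cI.
  apply: (@wandering_not_ergodic (F c) c); try lra.
  move=> x k xc; have xI : l < x < m by lra.
  suff : iter k.+1 Fext x < F c by lra.
  elim: k => [|k ih].
    by rewrite /= FextI//; apply: F_mono; (try exact: I_third); lra.
  by rewrite iterS FextI ?iterI//; have := H _ (iterI k.+1 xI); lra.
apply: (@wandering_not_ergodic c (F c)); try lra.
move=> x k xc; have xI : l < x < m by lra.
suff : F c < iter k.+1 Fext x by lra.
elim: k => [|k ih].
  by rewrite /= FextI//; apply: F_mono; (try exact: I_third); lra.
by rewrite iterS FextI ?iterI//; have := H _ (iterI k.+1 xI); lra.
Qed.

End attracting.

(** The increasing first branch has derivative [be / (3 * al)] at its fixed point 0. If this exceeds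
    1, then 0 attracts under [F]. *)
Lemma ergodic_left : ergodic F -> u ord0 = 0 -> be ord0 <= 3 * al ord0.
Proof.
move=> eF u0; rewrite leNgt; apply/negP => ab.
have v0 : v ord0 = 1/3 by case: (uv ord0) => /= -[]; rewrite u0; lra.
have a := al0 ord0; have b := be0 ord0.
have ba : 0 < be ord0 - al ord0 by lra.
(* The fixed point of the first branch other than 0; it bounds the interval attracted to 0. *)
pose xs := (be ord0 / 3 - al ord0) / (be ord0 - al ord0).
have xs0 : 0 < xs by rewrite /xs divr_gt0//; lra.
have xs3 : xs < 1/3 by rewrite /xs ltr_pdivrMr//; lra.
have It (x : R) : 0 < x < xs -> third ord0 x.
  by move=> ?; apply/in_third => /=; lra.
have Fx (x : R) : 0 < x < xs -> 0 < F x < x.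
  move=> xx; have [_ ->] := third_inv (It _ xx).
  have k : x * (be ord0 - al ord0) < be ord0 / 3 - al ord0.
    by rewrite -ltr_pdivlMr//; case/andP: xx.
  have x0 : 0 < x by lra.
  have d0 : 0 < al ord0 * (x - 0) + be ord0 * (1/3 - x) by nra.
  rewrite u0 v0 divr_gt0//=; last by nra.
  rewrite ltr_pdivrMr//.
  suff : 0 < x * (be ord0 / 3 - al ord0 - x * (be ord0 - al ord0)) by lra.
  by apply: mulr_gt0 => //; lra.
apply: (@attracting_not_ergodic ord0 0 xs) => //.
- by rewrite u0 v0; lra.
- by move=> x xx; have := Fx x xx; lra.
- by left => x xx; have := Fx x xx; lra.
Qed.

Lemma ergodic_right : ergodic F -> u (inord 2) = 2/3 ->
  al (inord 2) <= 3 * be (inord 2).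
Proof.
set o := inord 2; move=> eF u0; rewrite leNgt; apply/negP => ab.
have v0 : v o = 1.
  by have := uv o; rewrite {2 4 6 8}/o inordK//= u0 => -[] -[]; lra.
have a := al0 o; have b := be0 o.
have ba : 0 < al o - be o by lra.
(* The fixed point of the last branch other than 1. *)
pose xs := (2 / 3 * al o) / (al o - be o).
have xs0 : 2/3 < xs by rewrite /xs ltr_pdivlMr//; lra.
have xs3 : xs < 1 by rewrite /xs ltr_pdivrMr//; lra.
have It (x : R) : xs < x < 1 -> third o x.
  by move=> ?; apply/in_third; rewrite /o inordK//; lra.
have Fx (x : R) : xs < x < 1 -> x < F x < 1.
  move=> xx; have [F01x _] := F_third (It _ xx).
  have [_ e] := third_inv (It _ xx).
  have k : 2 / 3 * al o < x * (al o - be o).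
    by rewrite -ltr_pdivrMr//; case/andP: xx.
  have x1 : 0 < 1 - x by lra.
  have d0 : 0 < al o * (x - 2/3) + be o * (1 - x) by nra.
  suff : x < F x by lra.
  rewrite e u0 v0 ltr_pdivlMr//.
  suff : 0 < (1 - x) * (x * (al o - be o) - 2 / 3 * al o) by lra.
  by apply: mulr_gt0 => //; lra.
apply: (@attracting_not_ergodic o xs 1) => //.
- by rewrite u0 v0; lra.
- by move=> x xx; have := Fx x xx; lra.
- by right => x xx; have := Fx x xx; lra.
Qed.

Lemma invariant_scale (m m' : {measure set (measurableTypeR R) -> \bar R})
    (c : R) : 0 < c -> (forall E, measurable E -> m' E = (c%:E * m E)%E) ->
  invariant_measure F m -> invariant_measure F m'.
Proof.
move=> c0 mE [mout mT [K TK mK] mL minv].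
split.
- by rewrite (mE _ mI01C) mout mule0.
- rewrite mE//; apply: contra_neq mT => /eqP.
  by rewrite mule_eq0 eqe gt_eqF//= => /eqP.
- exists K => // i; have [mKi Ki] := mK i; split => //.
  by rewrite mE//; apply: lte_mul_pinfty => //; rewrite lee_fin ltW.
- move/null_content_dominatesP : mL => mL; apply/null_content_dominatesP.
  by move=> A mA A0; rewrite mE// mL// mule0.
- move=> E mEE; rewrite !mE//; last first.
    rewrite preimage_F; apply: (measurableI _ _ mI01).
    exact: measurable_Fext_preimage.
  by rewrite minv.
Qed.

(** * The density given by the dual *)

Section weight.
(* [p], [r], [s] are the values at (0,0), (0,1), (1,1) of the symmetric
   biaffine polynomial [q]; [sym] says that the matrix of psi intertwines the j-th branch
   and its adjoint. *)
Variables (p r s : R).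
Hypotheses (p0 : 0 <= p) (r0 : 0 < r) (s0 : 0 <= s).
Hypothesis sym : forall j,
  al j * (r * (1 - u j) + s * u j) = be j * (p * (1 - v j) + r * v j).

Definition q0 (x : R) := p * (1 - x) + r * x.

Definition q1 (x : R) := r * (1 - x) + s * x.

Definition q (x w : R) := q0 x * (1 - w) + q1 x * w.

Lemma q0_gt0 x : 0 < x < 1 -> 0 < q0 x.
Proof. by rewrite /q0 => ?; have := p0; have := r0; nra. Qed.

Lemma q1_gt0 x : 0 < x < 1 -> 0 < q1 x.
Proof. by rewrite /q1 => ?; have := s0; have := r0; nra. Qed.

Lemma q_gt0 x w : 0 < x < 1 -> 0 <= w <= 1 -> 0 < q x w.
Proof.
move=> x01 w01; have := q0_gt0 x01; have := q1_gt0 x01; rewrite /q => a b.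
have [->|w0] := eqVneq w 0; first by nra.
have : 0 < w by rewrite lt_neqAle eq_sym w0; lra.
nra.
Qed.

(** Both sides are affine in [x]. They agree at 0 trivially and at 1 by [sym]. *)
Lemma q0_flX j x : bden j x != 0 -> bden j x * q0 (fl (X j) x) = al j * q x (u j).
Proof.
move=> /bden_flX e; have e' := congr1 ( *%R x) (sym j).
rewrite /q0; transitivity (p * (bden j x - bden j x * fl (X j) x) +
  r * (bden j x * fl (X j) x)); first by ring.
by rewrite e /bden /q /q0 /q1; lra.
Qed.

(** Here the agreement is trivial at 1 and is [sym] at 0. *)
Lemma q1_flX j x : bden j x != 0 -> bden j x * q1 (fl (X j) x) = be j * q x (v j).
Proof.
move=> /bden_flX e; have e' := congr1 ( *%R (1 - x)) (sym j).
rewrite /q1; transitivity (r * (bden j x - bden j x * fl (X j) x) +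
  s * (bden j x * fl (X j) x)); first by ring.
by rewrite e /bden /q /q0 /q1; lra.
Qed.

(** * The natural dual *)

(** The entries are the coefficients of [q] in the monomials [1], [x], [w], [x * w]. *)
Definition psi : 'M[R]_2 := mx2 p (r - p) (r - p) (s - 2 * r + p).

Lemma psi_den x : fl_den psi x = q0 x.
Proof. by rewrite fl_den_mx2 /q0; ring. Qed.

Lemma fl_psi x : q0 x != 0 -> fl psi x = q1 x / q0 x - 1.
Proof.
move=> d0; rewrite fl_mx2.
have -> : p + (r - p) * x = q0 x by rewrite /q0; ring.
have -> : r - p + (s - 2 * r + p) * x = q1 x - q0 x by rewrite /q0 /q1; ring.
by field.
Qed.

Lemma adj_den j t : 0 < t < 1 -> fl_den (X j)^T (fl psi t) =
  al j * q t (u j) / q0 t.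
Proof.
move=> t01; have q0t := lt0r_neq0 (q0_gt0 t01).
by rewrite XE tr_mx2 fl_den_mx2 fl_psi// /q; field.
Qed.

(** By [q0_flX] and [q1_flX], both sides increased by 1 equal [be j * q t (v j)] divided by
    [al j * q t (u j)]. *)
Lemma psi_adj j t : 0 < t < 1 ->
  fl_den (X j)^T (fl psi t) != 0 /\
  fl psi (fl (X j) t) = fl (X j)^T (fl psi t).
Proof.
move=> t01; have t01' : 0 <= t <= 1 by lra.
have [u01 v01 _] := uvP j.
have q0t := lt0r_neq0 (q0_gt0 t01).
have qt := lt0r_neq0 (q_gt0 t01 u01).
have alj := lt0r_neq0 (al0 j).
split.
  by rewrite adj_den// !mulf_neq0// invr_eq0.
have dt := lt0r_neq0 (bden_gt0 j t01').
have q0X : q0 (fl (X j) t) != 0.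
  by apply/eqP => e; have /eqP := q0_flX dt; rewrite e mulr0 eq_sym !mulf_eq0 (negPf alj) (negPf qt).
rewrite fl_psi// /fl adj_den//.
have -> : q1 (fl (X j) t) / q0 (fl (X j) t) - 1 =
    (be j * q t (v j)) / (al j * q t (u j)) - 1.
  by rewrite -q0_flX// -q1_flX//; field; rewrite dt q0X.
have -> : (X j)^T 1 0 + (X j)^T 1 1 * fl psi t =
    (be j * q t (v j) - al j * q t (u j)) / q0 t.
  rewrite XE tr_mx2 !mxE /= fl_psi// /q; field => //.
by field; rewrite q0t qt alj.
Qed.

Section regular.
Hypothesis reg : p * s != r ^+ 2.
(** This is minus the determinant of [psi]. *)
Let De := r ^+ 2 - p * s.
Let De0 : De != 0. Proof. by rewrite /De subr_eq0 eq_sym. Qed.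

(** Solving [(y + 1) * q0 t = q1 t] gives [ta y : tb y = t : 1 - t], so that [inv] is the inverse of
    [psi]. *)
Let ta (y : R) := r - (y + 1) * p.
Let tb (y : R) := (y + 1) * r - s.
Let inv (y : R) := ta y / (ta y + tb y).

Let taE t : 0 < t < 1 -> ta (fl psi t) = t * (De / q0 t).
Proof.
move=> t01; have q0t := lt0r_neq0 (q0_gt0 t01).
by rewrite /ta fl_psi// /De; move: q0t; rewrite /q0 /q1 => ?; field.
Qed.

Let tbE t : 0 < t < 1 -> tb (fl psi t) = (1 - t) * (De / q0 t).
Proof.
move=> t01; have q0t := lt0r_neq0 (q0_gt0 t01).
by rewrite /tb fl_psi// /De; move: q0t; rewrite /q0 /q1 => ?; field.
Qed.

Let psiK t : 0 < t < 1 -> inv (fl psi t) = t.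
Proof.
move=> t01; have q0t := lt0r_neq0 (q0_gt0 t01).
rewrite /inv taE// tbE// -mulrDl addrCA subrr addr0 mul1r.
by field; rewrite De0 q0t.
Qed.

(** By [taE] and [tbE] the inequalities [l < t < m] become affine in [y]; the factor [De] absorbs
    the orientation of [psi]. So the image is open and convex, also when it is unbounded, as for
    [l = p = 0]. *)
Let image (l m : R) : 0 <= l -> l < m -> m <= 1 ->
  fl psi @` `]l, m[ = [set y | 0 < De * ((1 - l) * ta y - l * tb y)] `&`
                      [set y | 0 < De * (m * tb y - (1 - m) * ta y)].
Proof.
move=> l0 lm m1; apply/seteqP; split => [y [t]|y [/= H1 H2]].
  rewrite /= in_itv /= => tlm <-.
  have t01 : 0 < t < 1 by lra.
  have q0t := q0_gt0 t01.
  rewrite taE// tbE//.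
  have -> : De * ((1 - l) * (t * (De / q0 t)) - l * ((1 - t) * (De / q0 t))) =
    De ^+ 2 / q0 t * (t - l) by ring.
  have -> : De * (m * ((1 - t) * (De / q0 t)) - (1 - m) * (t * (De / q0 t))) =
    De ^+ 2 / q0 t * (m - t) by ring.
  have : 0 < De ^+ 2 / q0 t by rewrite divr_gt0// exprn_even_gt0.
  by move=> ?; split; apply: mulr_gt0 => //; lra.
have lm0 : 0 < m - l by lra.
have m0 : 0 < m by lra.
have l1 : 0 < 1 - l by lra.
have m10 : 0 <= 1 - m by lra.
have Ha : 0 < De * ta y.
  have := mulr_gt0 m0 H1; have := mulr_ge0 l0 (ltW H2) => h2 h1.
  by rewrite -(pmulr_rgt0 _ lm0); lra.
have Hb : 0 < De * tb y.
  have := mulr_ge0 m10 (ltW H1); have := mulr_gt0 l1 H2 => h2 h1.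
  by rewrite -(pmulr_rgt0 _ lm0); lra.
have ab0 : ta y + tb y != 0.
  by apply/eqP => e; have : De * (ta y + tb y) = 0 by [rewrite e mulr0]; lra.
have e1 : inv y = (De * ta y) / (De * ta y + De * tb y).
  by rewrite /inv -mulrDr; field; rewrite De0 ab0.
have pos : 0 < De * ta y + De * tb y by lra.
have lmi : l < inv y < m.
  by rewrite e1 ltr_pdivlMr// ltr_pdivrMr//; apply/andP; split; nra.
exists (inv y) => //=.
have i01 : 0 < inv y < 1 by lra.
have q0i := lt0r_neq0 (q0_gt0 i01).
rewrite fl_psi//.
suff e : q1 (inv y) = (y + 1) * q0 (inv y) by rewrite e mulfK// addrK.
by rewrite /q0 /q1 /inv /ta /tb; field; move: ab0; rewrite /ta /tb.
Qed.

Let affine (c e : R) : open [set y : R | 0 < c + e * y].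
Proof.
have -> : [set y : R | 0 < c + e * y] = (fun y => c + e * y) @^-1` [set x | 0 < x].
  by [].
apply: open_comp; last exact: open_gt.
by move=> y _; apply: cvgD; [exact: cvg_cst|apply: cvgMr; exact: cvg_id].
Qed.

Let affine_itv (a b x y z : R) : 0 < a + b * x -> 0 < a + b * y ->
  x <= z <= y -> 0 < a + b * z.
Proof. by move=> ? ? /andP[? ?]; have [h|h] := leP 0 b; nra. Qed.

Let image_open (l m : R) : 0 <= l -> l < m -> m <= 1 ->
  open (fl psi @` `]l, m[) /\ is_interval (fl psi @` `]l, m[).
Proof.
move=> l0 lm m1; rewrite image//.
have -> : [set y | 0 < De * ((1 - l) * ta y - l * tb y)] =
  [set y | 0 < De * ((1 - l) * (r - p) - l * (r - s)) +
      De * (- (1 - l) * p - l * r) * y].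
  by apply/seteqP; split => y; rewrite /= /ta /tb => H; (apply: le_lt_trans H _ || apply: lt_le_trans H _); rewrite le_eqVlt; apply/orP; left; apply/eqP; ring.
have -> : [set y | 0 < De * (m * tb y - (1 - m) * ta y)] =
  [set y | 0 < De * (m * (r - s) - (1 - m) * (r - p)) +
      De * (m * r + (1 - m) * p) * y].
  by apply/seteqP; split => y; rewrite /= /ta /tb => H; (apply: le_lt_trans H _ || apply: lt_le_trans H _); rewrite le_eqVlt; apply/orP; left; apply/eqP; ring.
split; first by apply: openI; exact: affine.
by move=> x y [/= x1 x2] [/= y1 y2] z xz; split; exact: affine_itv xz.
Qed.

Let B := fl psi @` `]0, 1[.
Let J (j : 'I_3) := fl psi @` (third j : set R).
(** The conjugate of [F] by [psi]. On [B] the default value [y] occurs at most at the images of 1/3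
    and 2/3, where [F] may take the value 0 or 1; it keeps [B] mapped to itself. *)
Let F' (y : R) := if 0 < F (inv y) < 1 then fl psi (F (inv y)) else y.

Let BP y : B y -> exists2 t, 0 < t < 1 & y = fl psi t.
Proof. by move=> [t /=]; rewrite in_itv => ? <-; exists t. Qed.

Let inB t : 0 < t < 1 -> B (fl psi t).
Proof. by move=> t01; exists t => //=; rewrite in_itv. Qed.

Let F'E j t : third j t -> F' (fl psi t) = fl psi (F t).
Proof.
by move=> jt; rewrite /F' psiK ?(third01 jt)// (F_third jt).1.
Qed.

Let psi_inj t t' : 0 < t < 1 -> 0 < t' < 1 -> fl psi t = fl psi t' -> t = t'.
Proof. by move=> t0 t0' e; rewrite -(psiK t0) -(psiK t0') e. Qed.

Lemma regular_natural_dual : natural_dual X F B F'.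
Proof.
have [Bo Bi] : open B /\ is_interval B by apply: image_open => //; lra.
have Bint : B° = B by apply/interior_id.
split; last first.
  exists p, (r - p), (s - 2 * r + p); split.
  - by move=> t t01; rewrite psi_den lt0r_neq0 ?q0_gt0.
  - rewrite Bint; split.
    + by move=> t /=; rewrite in_itv; exact: inB.
    + move=> t t'; rewrite !inE /= !in_itv; exact: psi_inj.
    + by move=> y /BP[t t01 ->]; exists t => //=; rewrite in_itv.
  - by move=> j t jt; rewrite (F'E jt).
  - by move=> j t t01; rewrite (psi_adj j t01).2.
split => //.
  by rewrite Bint; exists (fl psi (1/2)); apply: inB; lra.
exists J; split.
- move=> j; have [j0 j3] := ord_le3 j.
  have [] := @image_open (j%:R / 3) (j.+1%:R / 3).
  + by rewrite divr_ge0.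
  + by rewrite -[j.+1%:R]natr1; lra.
  + by rewrite -[j.+1%:R]natr1; lra.
  split => // _ [t jt <-]; apply: inB; exact: third01 jt.
- move=> i j _ _ [y [[t it <-] [t' jt' e]]].
  have tt' := psi_inj (third01 jt') (third01 it) e; subst t'.
  move/in_third: it => it; move/in_third: jt' => jt.
  apply/val_inj/eqP; rewrite /= eqn_leq -(ltnS i j) -(ltnS j i) -2!(ltr_nat R).
  by apply/andP; split; lra.
- apply: (@sub_finite_set _ _ [set fl psi (1/3); fl psi (2/3)]); last first.
    exact: finite_set2.
  move=> y [/BP[t t01 ->] nJ].
  have nt j : ~ third j t by move=> jt; apply: nJ; exists j => //; exists t.
  have := nt ord0; have := nt (inord 1); have := nt (inord 2).
  rewrite !in_third !inordK//= => H2 H1 H0.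
  have [->|n1] := eqVneq t (1/3); first by left.
  have [->|n2] := eqVneq t (2/3); first by right.
  exfalso.
  move: n1 n2; rewrite !neq_lt => /orP[n1|n1] /orP[n2|n2].
  + by apply: H0; lra.
  + by apply: H0; lra.
  + by apply: H1; lra.
  + by apply: H2; lra.
- split.
    move=> y /BP[t t01 ->]; rewrite /F' psiK//.
    by case: ifPn => ?; exact: inB.
  move=> j; rewrite Bint; split.
  + split.
    * by move=> _ [t jt <-]; rewrite (F'E jt); apply: inB; exact: (F_third jt).1.
    * move=> _ _ /set_mem[t jt <-] /set_mem[t' jt' <-].
      rewrite (F'E jt) (F'E jt') => e.
      have e' := psi_inj (F_third jt).1 (F_third jt').1 e.
      by rewrite -(F_third jt).2 -(F_third jt').2 e'.
    * move=> y /BP[t t01 ->]; have [jX FX] := F_flX j t01.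
      by exists (fl psi (fl (X j) t)); [exists (fl (X j) t)|rewrite (F'E jX) FX].
  + by move=> y /BP[t t01 ->]; exact: (psi_adj j t01).1.
  + move=> _ [t jt <-]; have [Ft XF] := F_third jt.
    by rewrite (F'E jt) -(psi_adj j Ft).2 XF.
Qed.

End regular.

(** If [p * s = r ^ 2], then [psi] is constant with value [(r - p) / p], and this point is fixed by
    all the adjoints. *)
Lemma has_dual : has_natural_dual X F.
Proof.
have [e|reg] := eqVneq (p * s) (r ^+ 2); last first.
  by left; do 2 eexists; exact: (regular_natural_dual reg).
right.
have pp : 0 < p.
  rewrite lt_neqAle p0 andbT; apply/eqP => p00.
  by move: e; rewrite -p00 mul0r => /esym/eqP; rewrite sqrf_eq0 => /eqP e; move: r0; rewrite e ltxx.
exists ((r - p) / p) => j.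
have [u01 v01 _] := uvP j.
have d : fl_den (X j)^T ((r - p) / p) = al j * q0 (u j) / p.
  by rewrite XE tr_mx2 fl_den_mx2 /q0; field; rewrite gt_eqF.
have qu : 0 < q0 (u j).
  rewrite /q0; have [->|w0] := eqVneq (u j) 0; first by nra.
  have : 0 < u j by rewrite lt_neqAle eq_sym w0; lra.
  have := r0; nra.
rewrite d; split.
  by rewrite !mulf_neq0 ?invr_eq0 ?gt_eqF.
rewrite /fl d XE tr_mx2 !mxE /=.
have al' := lt0r_neq0 (al0 j); have p' := lt0r_neq0 pp.
have eb : be j * q0 (v j) = al j * q0 (u j) * r / p.
  apply: (canRL (mulfK p')); rewrite -[be j * q0 (v j)]sym /q0.
  have := congr1 (fun z => al j * z * u j) e; lra.
have -> : (be j - al j + (be j * v j - al j * u j) * ((r - p) / p)) =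
  (be j * q0 (v j) - al j * q0 (u j)) / p.
  by rewrite /q0; field.
rewrite eb; move: (q0 (u j)) qu => z /lt0r_neq0 z0.
by field; rewrite al' p' z0.
Qed.

(** * The measure with the dual density *)

(** For [y = fl psi w] one has [1 + x * y = q x w / q0 w]. So for a nonsingular [psi] this is, up to
    a factor, the integral of [1 / (1 + x * y) ^ 2] over the dual interval; in the singular case it
    is proportional to [1 / (1 + xi * x) ^ 2]. *)
Definition dens (x : R) : R := (q0 x * q1 x)^-1.

Definition edens : R -> \bar R := (EFin \o dens) \_ `]0, 1[.

Lemma continuous_dens x : 0 < x < 1 -> {for x, continuous dens}.
Proof.
move=> x01; have a := q0_gt0 x01; have b := q1_gt0 x01.
apply: cvgV; first by rewrite mulf_neq0 ?gt_eqF.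
by apply: cvgM; apply: cvgD; apply: cvgMr => //; apply: cvgB => //;
  exact: cvg_cst.
Qed.

Lemma measurable_edens : measurable_fun setT edens.
Proof.
have mD : measurable_fun (`]0, 1[ : set R) dens.
  apply: open_continuous_measurable_fun; first exact: interval_open.
  by move=> x; rewrite inE /= in_itv; exact: continuous_dens.
have mED : measurable_fun (`]0, 1[ : set R) (EFin \o dens).
  exact: measurableT_comp.
exact: (measurable_restrictT _ _).1.
Qed.

Lemma dens_gt0 x : 0 < x < 1 -> 0 < dens x.
Proof. by move=> x01; rewrite invr_gt0 mulr_gt0 ?q0_gt0 ?q1_gt0. Qed.

Lemma edensE x : 0 < x < 1 -> edens x = (dens x)%:E.
Proof. by move=> x01; rewrite /edens patchE mem_set//= in_itv. Qed.

Lemma edens_out x : ~ (0 < x < 1) -> edens x = 0%E.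
Proof. by move=> x01; rewrite /edens patchE memNset//= in_itv. Qed.

Lemma edens_ge0 x : (0 <= edens x)%E.
Proof.
have [x01|x01] := pselect (0 < x < 1); last by rewrite edens_out.
by rewrite edensE// lee_fin ltW// dens_gt0.
Qed.

Definition dual_measure : {measure set (measurableTypeR R) -> \bar R} :=
  density_measure L measurable_edens edens_ge0.

Lemma dual_measureE E : dual_measure E = (\int[L]_(x in E) edens x)%E.
Proof. by []. Qed.

Lemma dual_measure_dominated : dual_measure `<< L.
Proof.
apply/null_content_dominatesP => A mA A0; rewrite dual_measureE.
by apply: null_set_integral => //; apply: measurable_funTS; exact: measurable_edens.
Qed.

(** The density is positive on []0, 1[], so [integral_eq_lt_null] applies to it and the zero
    function. *)
Lemma dual_measure_dominates E : measurable E -> dual_measure E = 0%E -> L (E `&` `]0, 1[) = 0%E.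
Proof.
move=> mE E0.
have := @integral_eq_lt_null _ _ _ L (cst 0%E) edens E mE (measurable_cst _)
  measurable_edens (fun=> lexx _) (fun x _ => edens_ge0 x).
rewrite -dual_measureE E0 integral_cst// mul0e => /(_ erefl (ltry _)).
apply: subset_measure0.
- by apply: measurableI.
- apply: measurableI => //; rewrite -[X in measurable X]setTI.
  by apply: emeasurable_fun_o_infty => //; exact: measurable_edens.
- move=> x [Ex]; rewrite /= in_itv /= => x01; split => //=.
  by rewrite edensE// lte_fin dens_gt0.
Qed.

Lemma dual_measure_out : dual_measure (~` `]0, 1[) = 0%E.
Proof.
rewrite dual_measureE; apply: integral0_eq => x; rewrite /= in_itv /= => /negP x01.
by apply: edens_out; exact/negP.
Qed.

Lemma dual_measure_set1 (a : R) : dual_measure [set a] = 0%E.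
Proof.
have /null_content_dominatesP := dual_measure_dominated; apply => //.
exact: lebesgue_measure_set1.
Qed.

Lemma dual_measure_itv (a b : R) : 0 < a -> b < 1 -> (dual_measure (`]a, b]%classic) < +oo)%E.
Proof.
move=> a0 b1; rewrite dual_measureE.
have [ab|ba] := ltP a b; last first.
  by rewrite set_itv_ge ?integral_set0// bnd_simp -leNgt.
(* On []a, b]] one has [q0 x >= r * a] and [q1 x >= r * (1 - b)], because [p] and [s] are
   nonnegative. *)
pose C := (r * a * (r * (1 - b)))^-1.
apply: (@le_lt_trans _ _ (\int[L]_(x in `]a, b]) (cst C%:E x))%E).
  apply: ge0_le_integral => //.
  - by move=> x _; exact: edens_ge0.
  - by apply: measurable_funTS; exact: measurable_edens.
  - move=> x; rewrite /= in_itv /= => /andP[ax xb].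
    have x01 : 0 < x < 1 by lra.
    rewrite edensE// lee_fin /C /dens lef_pV2 ?posrE ?mulr_gt0 ?q0_gt0 ?q1_gt0 ?subr_gt0//.
    have P0 := p0; have R0 := r0; have S0 := s0.
    by apply: ler_pM; [apply: mulr_ge0; lra|apply: mulr_ge0; lra|
      rewrite /q0; nra|rewrite /q1; nra].
have Loo : (L (`]a, b]%classic) < +oo)%E.
  by rewrite lebesgue_measure_itv /=; case: ifP => // _; rewrite -EFinB ltry.
rewrite (@integral_cst _ _ _ L _ (measurable_itv _)).
apply: lte_mul_pinfty => //; rewrite lee_fin invr_ge0.
by apply: mulr_ge0; apply: mulr_ge0; have := r0; lra.
Qed.

Lemma offbranch_null : dual_measure offbranch = 0%E.
Proof.
have : dual_measure.-negligible offbranch.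
  apply: (@negligibleS _ (measurableTypeR R) R dual_measure (~` `]0, 1[ `|` ([set (1/3)] `|` [set (2/3)])) offbranch).
    move=> x nx; have [x01|?] := pselect (`]0, 1[%classic x); last by left.
    right; apply: contrapT => n12; apply: nx.
    move: x01; rewrite /= in_itv /= => x01.
    have [j jx] : exists j, third j x.
      apply: third_trichotomy => //; apply/eqP => e; apply: n12;
        by [left|right].
    by exists j.
  apply: negligibleU.
    by apply/negligibleP; [apply: measurableC|exact: dual_measure_out].
  by apply: negligibleU; apply/negligibleP => //; exact: dual_measure_set1.
by move/negligibleP; apply; exact: measurable_offbranch.
Qed.

Lemma dual_measure_split A : measurable A -> dual_measure A =
  (dual_measure (third ord0 `&` A) + (dual_measure (third (inord 1) `&` A) +
   dual_measure (third (inord 2) `&` A)))%E.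
Proof.
move=> mA.
have mT j : measurable (third j `&` A : set (measurableTypeR R)).
  by apply: measurableI => //; exact: measurable_third.
have mB : measurable (offbranch `&` A : set (measurableTypeR R)) by apply: measurableI => //; exact: measurable_offbranch.
have B0 : dual_measure (offbranch `&` A) = 0%E.
  exact: (@subset_measure0 _ (measurableTypeR R) _ dual_measure _ _ mB measurable_offbranch
    (@subIsetl _ _ _) offbranch_null).
have {1}-> : A = ((third ord0 `&` A) `|` ((third (inord 1) `&` A) `|`
    (third (inord 2) `&` A))) `|` (offbranch `&` A).
  apply/seteqP; split; last by move=> x [[[]|[[]|[]]]|[]].
  move=> x Ax; have [[j _ jx]|nx] := pselect ((\bigcup_j third j) x); last by right.
  left; have [j0|] := eqVneq j ord0; first by left; rewrite -j0.
  have [j1 _|] := eqVneq j (inord 1); first by right; left; rewrite -j1.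
  move=> j1 j0; right; right; split => //; rewrite (_ : inord 2 = j)//.
  apply/val_inj; rewrite /= inordK//.
  move: j1 j0 {jx}; rewrite -!val_eqE /= inordK//.
  by case: j => -[|[|[|]]].
have disj (i j : 'I_3) : i != j -> (third i `&` A) `&` (third j `&` A) = set0 :> set R.
  move=> ij; apply/seteqP; split => // x [[/in_third xi _] [/in_third xj _]].
  have : (i < j)%N || (j < i)%N by rewrite -neq_ltn.
  case/orP; rewrite -ltnS -(ltr_nat R) => lij.
    have : (i.+1%:R : R) <= j%:R by rewrite ler_nat -ltnS -(ltr_nat R).
    lra.
  have : (j.+1%:R : R) <= i%:R by rewrite ler_nat -ltnS -(ltr_nat R).
  lra.
have m12 := measurableU _ _ (mT (inord 1)) (mT (inord 2)).
rewrite (measureU0 (measurableU _ _ (mT ord0) m12) mB B0).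
rewrite (measureU _ (mT ord0) m12); last first.
  by rewrite setIUr !disj ?setU0// -val_eqE /= inordK.
by rewrite (measureU _ (mT _) (mT _))// disj// -val_eqE /= !inordK.
Qed.

(* [dens x] is the integral of [(q x y)^-2] over [0,1], and [share j x] is the
   part of it which comes from the j-th third. *)
Definition share (j : 'I_3) (x : R) : R :=
  (3 * (q x (j%:R / 3) * q x (j.+1%:R / 3)))^-1.

Lemma dens_flX j x : 0 < x < 1 ->
  dens (fl (X j) x) * `|al j * be j * (v j - u j) / bden j x ^+ 2| = share j x.
Proof.
move=> x01.
have [u01 v01 _] := uvP j.
have d0 : 0 < bden j x by apply: bden_gt0; lra.
have a0 := al0 j; have b0 := be0 j.
have Qu := q_gt0 x01 u01; have Qv := q_gt0 x01 v01.
have e0 := q0_flX (lt0r_neq0 d0); have e1 := q1_flX (lt0r_neq0 d0).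
have vu : `|v j - u j| = 1 / 3.
  case: (uv j) => -[-> ->]; rewrite -[j.+1%:R]natr1.
    by rewrite ger0_norm; lra.
  by rewrite ler0_norm; lra.
have -> : share j x = (3 * (q x (u j) * q x (v j)))^-1.
  by rewrite /share; case: (uv j) => -[-> ->] //; rewrite [q _ _ * q _ _]mulrC.
rewrite normrM [`|_^-1|]gtr0_norm ?invr_gt0 ?exprn_gt0// normrM vu.
rewrite gtr0_norm ?mulr_gt0//.
have -> : dens (fl (X j) x) = bden j x ^+ 2 /
    (bden j x * q0 (fl (X j) x) * (bden j x * q1 (fl (X j) x))).
  have n0 : q0 (fl (X j) x) != 0.
    by apply/eqP => e; move: e0; rewrite e mulr0 => /esym/eqP; rewrite gt_eqF ?mulr_gt0.
  have n1 : q1 (fl (X j) x) != 0.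
    by apply/eqP => e; move: e1; rewrite e mulr0 => /esym/eqP; rewrite gt_eqF ?mulr_gt0.
  by rewrite /dens; field; rewrite n0 n1 gt_eqF.
rewrite e0 e1; field.
by rewrite !gt_eqF.
Qed.

(** As [q x] is affine in its second argument, the sum telescopes. It is checked as a rational
    identity in [q0 x] and [q1 x], which includes the case where these are equal. *)
Lemma share_sum x : 0 < x < 1 ->
  share ord0 x + (share (inord 1) x + share (inord 2) x) = dens x.
Proof.
move=> x01.
have Q (i : nat) : (i <= 3)%N -> q x (i%:R / 3) != 0.
  move=> i3; rewrite gt_eqF// q_gt0//.
  have : (i%:R : R) <= 3%:R by rewrite ler_nat.
  have : (0 : R) <= i%:R by rewrite ler0n.
  by lra.
have := Q 0%N isT; have := Q 1%N isT; have := Q 2 isT; have := Q 3 isT.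
have q00 : q x (0%:R / 3) = q0 x by rewrite /q; field.
have q33 : q x (3%:R / 3) = q1 x by rewrite /q; field.
have q11 : q x (1%:R / 3) = (2 * q0 x + q1 x) / 3 by rewrite /q; field.
have q22 : q x (2%:R / 3) = (q0 x + 2 * q1 x) / 3 by rewrite /q; field.
rewrite /share !inordK//= q00 q33 q11 q22 /dens.
move: (q0 x) (q1 x) => a b n3 n2 n1 n0.
have m1 : 2 * a + b != 0 by apply: contra_neq n1 => ->; rewrite mul0r.
have m2 : a + 2 * b != 0 by apply: contra_neq n2 => ->; rewrite mul0r.
by field; rewrite n0 m1 m2 n3.
Qed.

Lemma share_ge0 j x : 0 < x < 1 -> 0 <= share j x.
Proof.
move=> x01; have [u01 v01 _] := uvP j; rewrite invr_ge0.
have Qu := q_gt0 x01 u01; have Qv := q_gt0 x01 v01.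
apply: mulr_ge0 => //.
by move: Qu Qv; case: (uv j) => -[-> ->] ? ?; apply: mulr_ge0; exact: ltW.
Qed.

(** * Invariance of the dual measure *)

Lemma measurable_share j (a b : R) : 0 < a -> b < 1 ->
  measurable_fun (`[a, b] : set (measurableTypeR R)) (EFin \o share j).
Proof.
move=> a0 b1; apply: measurableT_comp => //.
apply: (@measurable_funS _ _ _ _ (`]0, 1[ : set (measurableTypeR R))) => //.
  by move=> x; rewrite /= !in_itv /=; lra.
apply: open_continuous_measurable_fun; first exact: interval_open.
move=> x; rewrite inE /= in_itv /= => x01.
have [u01 v01 _] := uvP j.
have Qu := q_gt0 x01 u01; have Qv := q_gt0 x01 v01.
have cq w : {for x, continuous (q ^~ w)}.
  apply: cvgD; apply: cvgMl; apply: cvgD; apply: cvgMr => //;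
    by apply: cvgB => //; exact: cvg_cst.
apply: cvgV.
  by move: Qu Qv; case: (uv j) => -[-> ->] ? ?; rewrite !mulf_neq0 ?gt_eqF.
by apply: cvgMr; apply: cvgM; exact: cq.
Qed.

(** Substitution along the branch, increasing or decreasing; [dens_flX] identifies the new integrand
    in both cases. *)
Lemma dual_measure_branch j (a b : R) : 0 < a -> a < b -> b < 1 ->
  dual_measure (third j `&` (Fext @^-1` `]a, b]%classic)) =
  (\int[L]_(x in (`[a, b]%classic : set (measurableTypeR R))) (share j x)%:E)%E.
Proof.
move=> a0 ab b1; rewrite preimage_branch//.
have a01 : 0 < a < 1 by lra.
have b01 : 0 < b < 1 by lra.
have [/third01 Xa _] := F_flX j a01; have [/third01 Xb _] := F_flX j b01.
have d0 x : x \in `[a, b] -> 0 < bden j x.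
  by rewrite in_itv /= => xab; apply: bden_gt0; lra.
have DE x : x \in `[a, b] -> (derive1 (fl (X j))) x =
    al j * be j * (v j - u j) / bden j x ^+ 2.
  by move=> /d0/lt0r_neq0 dx; rewrite derive1E; have [] := is_derive_flX dx.
have aI : a \in `[a, b] by rewrite in_itv /= lexx ltW.
have bI : b \in `[a, b] by rewrite in_itv /= lexx ltW.
have dc : derivable_oo_LRcontinuous (fl (X j)) a b.
  split.
  - move=> x xab; have dx : bden j x != 0.
      by rewrite lt0r_neq0// d0//; exact: subset_itv_oo_cc xab.
    by have [] := is_derive_flX dx.
  - by apply: cvg_at_right_filter; apply: continuous_flX; rewrite lt0r_neq0 ?d0.
  - by apply: cvg_at_left_filter; apply: continuous_flX; rewrite lt0r_neq0 ?d0.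
have cD : {in `]a, b[, continuous (derive1 (fl (X j)))}.
  move=> x xab; apply: continuous_derive_flX.
  by rewrite lt0r_neq0// d0//; exact: subset_itv_oo_cc xab.
have cr : cvg ((derive1 (fl (X j))) x @[x --> a^'+]).
  apply/cvg_ex; eexists; apply: cvg_at_right_filter.
  by apply: continuous_derive_flX; rewrite lt0r_neq0 ?d0.
have cl : cvg ((derive1 (fl (X j))) x @[x --> b^'-]).
  apply/cvg_ex; eexists; apply: cvg_at_left_filter.
  by apply: continuous_derive_flX; rewrite lt0r_neq0 ?d0.
have ic (x y : R) : 0 < x < 1 -> 0 < y < 1 -> {within `[x, y], continuous dens}.
  move=> x01 y01; apply: continuous_in_subspaceT => z.
  rewrite inE /= in_itv /= => zxy; apply: continuous_dens; lra.
have cc (x y : R) : 0 < x < 1 -> 0 < y < 1 ->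
    (\int[L]_(z in `[x, y]) edens z = \int[L]_(z in `[x, y]) (dens z)%:E)%E.
  move=> x01 y01; apply: eq_integral => z; rewrite inE /= in_itv /= => zxy.
  by apply: edensE; lra.
have mono x y : x \in `[a, b] -> y \in `[a, b] -> x < y ->
    exists2 c, 0 < c & fl (X j) y - fl (X j) x = c * (v j - u j).
  move=> /d0 dx /d0 dy xy.
  exists (al j * be j * (y - x) / (bden j x * bden j y)).
    by rewrite divr_gt0 ?mulr_gt0 ?subr_gt0.
  by rewrite flX_sub ?gt_eqF//; field; rewrite !gt_eqF.
rewrite dual_measureE; case: ifPn => [uv'|].
  rewrite integral_itv_obnd_cbnd; last first.
    by apply: measurable_funTS; exact: measurable_edens.
  rewrite cc// integration_by_substitution_increasing ?ltW//; last 2 first.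
  - move=> x y xab yab xy; have [c c0 e] := mono _ _ xab yab xy.
    by rewrite -subr_gt0 e mulr_gt0// subr_gt0.
  - exact: ic.
  apply: eq_integral => x; rewrite inE /= => xab; congr (_%:E).
  have x01 : 0 < x < 1 by move: xab; rewrite in_itv /=; lra.
  have pos : 0 <= al j * be j * (v j - u j) / bden j x ^+ 2.
    by rewrite divr_ge0 ?mulr_ge0 ?exprn_ge0 ?subr_ge0// ltW ?d0.
  by rewrite -dens_flX// ger0_norm// -DE.
rewrite -leNgt le_eqVlt => /orP[/eqP e|vu].
  by have [_ _] := uvP j; rewrite e eqxx.
rewrite integral_itv_bndo_bndc; last first.
  by apply: measurable_funTS; exact: measurable_edens.
rewrite cc// integration_by_substitution_decreasing ?ltW//; last 2 first.
- move=> x y xab yab xy; have [c c0 e] := mono _ _ yab xab xy.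
  have : 0 < c * (u j - v j) by rewrite mulr_gt0// subr_gt0.
  by move: e; lra.
- exact: ic.
apply: eq_integral => x; rewrite inE /= => xab; congr (_%:E).
have x01 : 0 < x < 1 by move: xab; rewrite in_itv /=; lra.
have neg : al j * be j * (v j - u j) / bden j x ^+ 2 <= 0.
  rewrite mulr_le0_ge0 ?invr_ge0 ?exprn_ge0//; last by rewrite ltW ?d0.
  by rewrite mulr_ge0_le0 ?mulr_ge0 ?subr_le0// ltW.
by rewrite -dens_flX// ler0_norm// -DE.
Qed.

Lemma dual_measure_inv_itv (a b : R) : 0 < a -> b < 1 ->
  dual_measure (Fext @^-1` `]a, b]%classic) = dual_measure (`]a, b]%classic).
Proof.
move=> a0 b1; have [ab|ba] := ltP a b; last first.
  by rewrite set_itv_ge ?preimage_set0// bnd_simp -leNgt.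
rewrite dual_measure_split; last first.
  by apply: measurable_Fext_preimage; exact: measurable_itv.
rewrite !dual_measure_branch// dual_measureE.
rewrite integral_itv_obnd_cbnd; last first.
  by apply: measurable_funTS; exact: measurable_edens.
have in01 x : (`[a, b]%classic : set (measurableTypeR R)) x -> 0 < x < 1.
  by rewrite /= in_itv /=; lra.
have ms j := measurable_share j a0 b1.
have g0 j x : (`[a, b]%classic : set (measurableTypeR R)) x -> (0 <= (share j x)%:E)%E.
  by move=> /in01 x01; rewrite lee_fin share_ge0.
have mI : measurable (`[a, b]%classic : set (measurableTypeR R)).
  exact: measurable_itv.
rewrite -(ge0_integralD L mI (g0 _) (ms _) (g0 _) (ms _)).
rewrite -(ge0_integralD L mI (g0 _) (ms _)); last 2 first.
- by move=> x xab; rewrite adde_ge0 ?g0.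
- by apply: emeasurable_funD; exact: ms.
apply: eq_integral => x; rewrite inE => /in01 x01.
by rewrite edensE// -share_sum.
Qed.

Lemma dual_measure_cpt n : (dual_measure (cpt n) < +oo)%E.
Proof.
rewrite /cpt; have [] := inv_n2 n; move: (n.+2%:R^-1) => a a0 a2.
by apply: dual_measure_itv => //; lra.
Qed.

Lemma dual_measure_sigma_finite : sigma_finite setT dual_measure.
Proof.
exists (fun n => cpt n `|` ~` `]0, 1[).
  apply/seteqP; split => // x _.
  have [|nx] := pselect ((`]0, 1[%classic : set (measurableTypeR R)) x).
    by rewrite -bigcup_cpt => -[n _ nx]; exists n => //; left.
  by exists 0%N => //; right.
move=> n; split.
  by apply: measurableU; [exact: measurable_cpt|exact: measurable_out].
rewrite (measureU0 (measurable_cpt n) measurable_out dual_measure_out); exact: dual_measure_cpt.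
Qed.

(** Restricted to [cpt n], where [dual_measure] is finite, the measure and its pushforward agree on
    half-open intervals, hence on Borel sets. Then [n] tends to infinity. *)
Lemma dual_measure_inv (E : set (measurableTypeR R)) :
  measurable E -> dual_measure (Fext @^-1` E) = dual_measure E.
Proof.
move=> mE.
pose pm_ : {measure set (measurableTypeR R) -> \bar R} :=
  pushforward dual_measure (Fext : measurableTypeR R -> measurableTypeR R).
pose pm := pm_ measurable_Fext.
have pmE A : pm A = dual_measure (Fext @^-1` A) by [].
rewrite -pmE.
have pmout : pm (~` `]0, 1[) = 0%E.
  rewrite pmE; have mO := measurable_Fext_preimage measurable_out.
  exact: (@subset_measure0 _ (measurableTypeR R) _ dual_measure _ _ mO measurable_offbranch
    preimage_out offbranch_null).
have eK n A : measurable A -> pm (A `&` cpt n) = dual_measure (A `&` cpt n).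
  move=> mA.
  pose r1 : {measure set (measurableTypeR R) -> \bar R} :=
    mrestr dual_measure (measurable_cpt n).
  pose r2 : {measure set (measurableTypeR R) -> \bar R} :=
    mrestr pm (measurable_cpt n).
  apply/esym; rewrite -[LHS]/(r1 A) -[RHS]/(r2 A).
  apply: (@measure_unique _ R (measurableTypeR R) (@ocitv R)
    (fun k => `](- k%:R), k%:R]%classic)) => //.
  - exact: ocitvI.
  - by move=> k; exists (- k%:R, k%:R).
  - apply/seteqP; split => // x _.
    exists (Num.truncn `|x|).+1 => //=; rewrite in_itv /=.
    have := truncnS_gt `|x|; rewrite ltr_norml => /andP[-> /ltW ->] //.
  - move=> _ [[a b] _ <-]; rewrite /r1 /r2 /= /mrestr pmE /cpt.
    have [? ?] := inv_n2 n.
    have -> : (`]a, b]%classic `&` `]n.+2%:R^-1, (1 - n.+2%:R^-1)]%classic) =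
        `](Num.max a n.+2%:R^-1), (Num.min b (1 - n.+2%:R^-1))]%classic :> set R.
      apply/seteqP; split => x; rewrite /= !in_itv /= gt_max le_min.
        by move=> [/andP[-> ->] /andP[-> ->]].
      by move=> /andP[/andP[-> ->] /andP[-> ->]].
    apply/esym.
    apply: dual_measure_inv_itv; first by rewrite lt_max; apply/orP; right.
    by rewrite gt_min; apply/orP; right; rewrite ltrBlDr ltrDl.
  - move=> k; apply: le_lt_trans (dual_measure_cpt n); rewrite /r1 /= /mrestr.
    apply: le_measure; rewrite ?inE; [|exact: measurable_cpt|exact: subIsetr].
    by apply: measurableI; [exact: measurable_itv|exact: measurable_cpt].
have c1 := cpt_cvg mE pmout; have c2 := cpt_cvg mE dual_measure_out.
move: c1; under eq_fun do rewrite eK//.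
by move=> c1; exact: cvg_unique _ c1 c2.
Qed.

Lemma dual_measure_out01 : dual_measure (~` `[0, 1]) = 0%E.
Proof.
apply: (subset_measure0 mI01C measurable_out _ dual_measure_out).
by move=> x /= nx x01; apply: nx; exact: subset_itv_oo_cc x01.
Qed.

Lemma dual_measure_invariant : invariant_measure F dual_measure.
Proof.
split.
- exact: dual_measure_out01.
- apply/eqP => e.
  have := dual_measure_dominates measurableT e.
  rewrite setTI lebesgue_measure_itv /= lte_fin ltr01 oppr0 adde0.
  by move=> /eqP; rewrite onee_eq0.
- exact: dual_measure_sigma_finite.
- exact: dual_measure_dominated.
- by move=> E mE; rewrite (preimage_inv dual_measure_out01 mE) dual_measure_inv.
Qed.

(** Inside []0, 1[] a null set of [dual_measure] is Lebesgue null; the points 0 and 1 are null for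
    [m] by absolute continuity. *)
Lemma invariant_dominated (m : {measure set (measurableTypeR R) -> \bar R}) :
  m (~` `[0, 1]) = 0%E -> m `<< L -> m `<< dual_measure.
Proof.
move=> mout /null_content_dominatesP mL.
apply/null_content_dominatesP => E mE E0.
have m1 : measurable (E `&` `]0, 1[) by apply: measurableI.
have n1 : m.-negligible (E `&` `]0, 1[).
  by apply/negligibleP => //; apply: mL => //; exact: dual_measure_dominates.
have ns (a : R) : m.-negligible [set a].
  by apply/negligibleP => //; apply: mL => //; exact: lebesgue_measure_set1.
have n2 : m.-negligible (~` I01) by apply/negligibleP.
suff : m.-negligible E by move/negligibleP; apply.
apply: (negligibleS _ (negligibleU n1 (negligibleU n2
  (negligibleU (ns 0) (ns 1))))).
move=> x Ex; have [x01|?] := pselect (I01 x); last by right; left.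
have [->|x0] := eqVneq x 0; first by right; right; left.
have [->|x1] := eqVneq x 1; first by right; right; right.
left; split => //; move: x01; rewrite /I01 /= !in_itv /= => /andP[h0 h1].
by rewrite !lt_neqAle h0 h1 x1 eq_sym x0.
Qed.

Lemma ergodic_dual_measure : ergodic F -> forall E : set (measurableTypeR R),
  measurable E -> Fext @^-1` E = E -> dual_measure E = 0%E \/ dual_measure (~` E) = 0%E.
Proof.
move=> eF E mE GE.
have /null_content_dominatesP dom := dual_measure_dominated.
have mE1 : measurable (E `&` I01) by exact: measurableI.
have n2 : dual_measure.-negligible (~` I01).
  by apply/negligibleP => //; exact: dual_measure_out01.
have [|||e|e] := eF (E `&` I01) => //.
- rewrite preimage_F preimage_setI GE; apply/seteqP; split.
    by move=> x [? []].
  by move=> x [Ex x01]; split => //; split => //; rewrite /I01 /= in_itv; exact: Fext01.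
- left; suff : dual_measure.-negligible E by move/negligibleP; apply.
  have n1 : dual_measure.-negligible (E `&` I01) by apply/negligibleP => //; exact: dom.
  apply: (negligibleS _ (negligibleU n1 n2)).
  by move=> x Ex; have [?|?] := pselect (I01 x); [left|right].
- right; have mC := measurableC mE.
  suff : dual_measure.-negligible (~` E) by move/negligibleP; apply.
  have mD : measurable (I01 `\` (E `&` I01)) by exact: measurableD.
  have n1 : dual_measure.-negligible (I01 `\` (E `&` I01)).
    by apply/negligibleP => //; exact: dom.
  apply: (negligibleS _ (negligibleU n1 n2)).
  move=> x nEx; have [x01|?] := pselect (I01 x); [left|by right].
  by split => // -[].
Qed.

(** * Recurrence and uniqueness *)

Section recurrence.
(* at least one of the two extreme branches fixes its endpoint of [0,1]; the
   iterates which stay near {0,1} then settle near a fixed endpoint, from which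
   they move away monotonically *)
Hypothesis noflip : u ord0 = 0 \/ u (inord 2) = 2 / 3.

Let o2 : 'I_3 := inord 2.
Let uv0 : (u ord0 = 0 /\ v ord0 = 1/3) \/ (u ord0 = 1/3 /\ v ord0 = 0).
Proof.
by case: (uv ord0) => /= -[h1 h2]; [left|right]; split; lra.
Qed.
Let uv2 : (u o2 = 2/3 /\ v o2 = 1) \/ (u o2 = 1 /\ v o2 = 2/3).
Proof.
by have := uv o2; rewrite {2 4 6 8}/o2 inordK//= => -[] -[h1 h2]; [left|right]; split; lra.
Qed.

(** [e0] and [e1] are the images of 1/2 under the first and the last branch: [F] maps the points of
    the first third below [e0], and those of the last third above [e1], into one half of []0,
    1[]. *)
Let e0 := (al ord0 * u ord0 + be ord0 * v ord0) / (al ord0 + be ord0).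
Let e1 := (al o2 * u o2 + be o2 * v o2) / (al o2 + be o2).

Let e0_gt0 : 0 < e0.
Proof.
have a := al0 ord0; have b := be0 ord0.
apply: divr_gt0; last exact: addr_gt0.
by case: uv0 => -[-> ->]; nra.
Qed.

Let e1_lt1 : e1 < 1.
Proof.
have a := al0 o2; have b := be0 o2; rewrite /e1 ltr_pdivrMr ?addr_gt0//.
by case: uv2 => -[-> ->]; nra.
Qed.

Let third_0 (x : R) : 0 < x < 1/3 -> third ord0 x.
Proof. by move=> ?; apply/in_third => /=; lra. Qed.
Let third_2 (x : R) : 2/3 < x < 1 -> third o2 x.
Proof. by move=> ?; apply/in_third; rewrite /o2 inordK//; lra. Qed.

Let left_stay (x : R) : u ord0 = 0 -> 0 < x < 1/3 -> x < e0 -> x < F x < 1/2.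
Proof.
move=> u0 x3; have a := al0 ord0; have b := be0 ord0.
have v0 : v ord0 = 1/3 by case: uv0 => -[] //; rewrite u0; lra.
have [_ ->] := third_inv (third_0 x3).
rewrite /e0 u0 v0 ltr_pdivlMr ?addr_gt0// => xe.
(* Here [sym] reads [3 * al * r = be * (2 * p + r)], and [p >= 0]: the fixed point 0 is not
   attracting. *)
have k : be ord0 <= 3 * al ord0.
  have := sym ord0; rewrite u0 v0 => s'; have P0 := p0; have R0 := r0.
  rewrite -(ler_pM2r R0); nra.
have d0 : 0 < al ord0 * (x - 0) + be ord0 * (1/3 - x) by nra.
rewrite ltr_pdivlMr// ltr_pdivrMr//; apply/andP; split; last by lra.
have x0 : 0 < x by lra.
suff : 0 < x * (al ord0 * (1 - x) - be ord0 * (1/3 - x)) by lra.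
by apply: mulr_gt0 => //; nra.
Qed.

Let left_flip (x : R) : u ord0 = 1/3 -> 0 < x < 1/3 -> x < e0 -> 1/2 < F x.
Proof.
move=> u0 x3; have a := al0 ord0; have b := be0 ord0.
have v0 : v ord0 = 0 by case: uv0 => -[] //; rewrite u0; lra.
have [_ ->] := third_inv (third_0 x3).
rewrite /e0 u0 v0 ltr_pdivlMr ?addr_gt0// => xe.
have d0 : 0 < al ord0 * (1/3 - x) + be ord0 * (x - 0) by nra.
have -> : al ord0 * (x - 1/3) / (al ord0 * (x - 1/3) + be ord0 * (0 - x)) =
  al ord0 * (1/3 - x) / (al ord0 * (1/3 - x) + be ord0 * (x - 0)).
  rewrite -mulrNN -invrN -mulrN; congr (_ * _ / _); lra.
by rewrite ltr_pdivlMr//; lra.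
Qed.

Let right_stay (x : R) : u o2 = 2/3 -> 2/3 < x < 1 -> e1 < x -> 1/2 < F x < x.
Proof.
move=> u0 x3; have a := al0 o2; have b := be0 o2.
have v0 : v o2 = 1 by case: uv2 => -[] //; rewrite u0; lra.
have [_ ->] := third_inv (third_2 x3).
rewrite /e1 u0 v0 ltr_pdivrMr ?addr_gt0// => xe.
have k : al o2 <= 3 * be o2.
  have := sym o2; rewrite u0 v0 => s'; have S0 := s0; have R0 := r0.
  rewrite -(ler_pM2r R0); nra.
have d0 : 0 < al o2 * (x - 2/3) + be o2 * (1 - x) by nra.
rewrite ltr_pdivlMr// ltr_pdivrMr//; apply/andP; split; first by lra.
have x1 : 0 < 1 - x by lra.
suff : 0 < (1 - x) * (be o2 * x - al o2 * (x - 2/3)) by lra.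
by apply: mulr_gt0 => //; nra.
Qed.

Let right_flip (x : R) : u o2 = 1 -> 2/3 < x < 1 -> e1 < x -> F x < 1/2.
Proof.
move=> u0 x3; have a := al0 o2; have b := be0 o2.
have v0 : v o2 = 2/3 by case: uv2 => -[] //; rewrite u0; lra.
have [_ ->] := third_inv (third_2 x3).
rewrite /e1 u0 v0 ltr_pdivrMr ?addr_gt0// => xe.
have d0 : 0 < al o2 * (1 - x) + be o2 * (x - 2/3) by nra.
have -> : al o2 * (x - 1) / (al o2 * (x - 1) + be o2 * (2/3 - x)) =
  al o2 * (1 - x) / (al o2 * (1 - x) + be o2 * (x - 2/3)).
  rewrite -mulrNN -invrN -mulrN; congr (_ * _ / _); lra.
by rewrite ltr_pdivrMr//; lra.
Qed.

Lemma orbit_recurrent (x : nat -> R) : (forall k, 0 < x k < 1) ->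
  (forall k, x k.+1 = F (x k)) ->
  exists i, forall n, exists2 k, (n <= k)%N & cpt i (x k).
Proof.
move=> x01 xS; apply: contrapT => H.
have ev (d : R) : 0 < d -> exists n, forall k, (n <= k)%N -> x k < d \/ 1 - d < x k.
  move=> /small_inv_n2[i id]; apply: contrapT => H1; apply: H; exists i => n.
  apply: contrapT => H2; apply: H1; exists n => k nk.
  apply: contrapT => H3; apply: H2; exists k => //; apply/cptP.
  apply/andP; split.
    by rewrite ltNge; apply/negP => h; apply: H3; left; exact: le_lt_trans id.
  rewrite leNgt; apply/negP => h; apply: H3; right; apply: lt_trans h.
  by rewrite ltrD2l ltrN2.
(* Within [d] of 0 or 1 a point lies in an extreme third, beyond [e0] or [e1]. A non-recurrent orbit
   finally stays within [d] of these two ends. *)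
have [d [dpos d3 de0 de1]] :
    exists d : R, [/\ 0 < d, d <= 1/3, d <= e0 & d <= 1 - e1].
  exists (Num.min (1/3) (Num.min e0 (1 - e1))); split.
  - by rewrite !lt_min e0_gt0 subr_gt0 e1_lt1 !andbT; lra.
  - by rewrite ge_min lexx.
  - by rewrite !ge_min lexx !orbT.
  - by rewrite !ge_min lexx !orbT.
have [n Hn] := ev d dpos.
(* From a point within [d] of the fixed end 0 the orbit increases, and it stays below [d] since its
   next value is below 1/2. It then remains above [x k], although it should eventually come
   arbitrarily close to 0 or 1. *)
have noleft k : u ord0 = 0 -> (n <= k)%N -> ~ x k < d.
  move=> u0 nk xk.
  have st m : x (k + m)%N < d /\ x k <= x (k + m)%N.
    elim: m => [|m [ih1 ih2]]; first by rewrite addn0.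
    have xm := x01 (k + m)%N.
    have : x (k + m)%N < F (x (k + m)%N) < 1/2 by apply: left_stay => //; lra.
    rewrite addnS xS => st.
    have : (n <= (k + m).+1)%N by rewrite (leq_trans nk)// -addnS leq_addr.
    by move=> /Hn; rewrite xS; lra.
  have dk : 0 < Num.min (x k) (1/2).
    by have := x01 k; rewrite lt_min; lra.
  have [n' Hn'] := ev _ dk.
  have [s1 s2] := st n'; have := Hn' (k + n')%N (leq_addl _ _).
  have : Num.min (x k) (1/2) <= x k by rewrite ge_min lexx.
  have : Num.min (x k) (1/2) <= 1/2 by rewrite ge_min lexx orbT.
  lra.
have noright k : u o2 = 2/3 -> (n <= k)%N -> ~ 1 - d < x k.
  move=> u0 nk xk.
  have st m : 1 - d < x (k + m)%N /\ x (k + m)%N <= x k.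
    elim: m => [|m [ih1 ih2]]; first by rewrite addn0.
    have xm := x01 (k + m)%N.
    have : 1/2 < F (x (k + m)%N) < x (k + m)%N by apply: right_stay => //; lra.
    rewrite addnS xS => st.
    have : (n <= (k + m).+1)%N by rewrite (leq_trans nk)// -addnS leq_addr.
    by move=> /Hn; rewrite xS; lra.
  have dk : 0 < Num.min (1 - x k) (1/2).
    by have := x01 k; rewrite lt_min; lra.
  have [n' Hn'] := ev _ dk.
  have [s1 s2] := st n'; have := Hn' (k + n')%N (leq_addl _ _).
  have : Num.min (1 - x k) (1/2) <= 1 - x k by rewrite ge_min lexx.
  have : Num.min (1 - x k) (1/2) <= 1/2 by rewrite ge_min lexx orbT.
  lra.
(* A fixed end is excluded at the times [n] and [n.+1]. If one end is flipped, the point is near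
   that end at time [n] and is sent to the half of the other, fixed end. *)
have xn := x01 n; have xn1 := x01 n.+1.
have Pn := Hn n (leqnn n); have Pn1 := Hn n.+1 (leqnSn n).
case: uv0 => -[u0 _].
  have nl := noleft n u0 (leqnn n); have nl1 := noleft n.+1 u0 (leqnSn n).
  case: uv2 => -[u2 _].
    by have := noright n u2 (leqnn n); lra.
  have : F (x n) < 1/2 by apply: right_flip => //; lra.
  by rewrite -xS; lra.
have u2 : u o2 = 2/3 by case: noflip => //; rewrite u0; lra.
have nr := noright n u2 (leqnn n); have nr1 := noright n.+1 u2 (leqnSn n).
have : 1/2 < F (x n) by apply: left_flip => //; lra.
by rewrite -xS; lra.
Qed.

Let N : set (measurableTypeR R) := \bigcup_k iter k Fext @^-1` offbranch.

Theorem invariant_measure_unique (m : {measure set (measurableTypeR R) -> \bar R}) :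
  ergodic F -> invariant_measure F m ->
  exists2 c : R, 0 < c & forall E, measurable E -> m E = (c%:E * dual_measure E)%E.
Proof.
move=> eF [mout mT mfin mL minv].
have mFext : measurable_fun setT (Fext : measurableTypeR R -> measurableTypeR R).
  exact: measurable_Fext.
have mN : measurable N.
  apply: bigcup_measurable => k _.
  by apply: (measurable_iter_preimage mFext); exact: measurable_offbranch.
have N0 : dual_measure N = 0%E.
  suff : dual_measure.-negligible N by move/negligibleP; apply.
  apply: negligible_bigcup => k; apply/negligibleP.
    by apply: (measurable_iter_preimage mFext); exact: measurable_offbranch.
  apply: (eq_trans (iter_inv mFext dual_measure_inv k measurable_offbranch)); exact: offbranch_null.
have rec x : ~ N x ->
    exists i, forall n, exists2 k, (n <= k)%N & cpt i (iter k Fext x).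
  move=> nN.
  have inT k : exists j, third j (iter k Fext x).
    apply: contrapT => H; apply: nN; exists k => // -[j _ jx].
    by apply: H; exists j.
  apply: orbit_recurrent => k; have [j jx] := inT k.
    exact: third01 jx.
  by rewrite /= (Fext_third jx).
apply: (@ergodic_invariant_unique _ _ _ dual_measure Fext dual_measure_sigma_finite mFext dual_measure_inv
  (ergodic_dual_measure eF) cpt N measurable_cpt dual_measure_cpt mN N0 rec) => //.
- exact: invariant_dominated.
- by move=> E mE; rewrite -(preimage_inv mout mE) minv.
Qed.

End recurrence.

End weight.

End triple.

Lemma same_invariant_measure_of_unique (R : realType) (F G : R -> R)
    (mu : {measure set (measurableTypeR R) -> \bar R}) :
  invariant_measure F mu ->
  (forall m : {measure set (measurableTypeR R) -> \bar R},
    invariant_measure F m <-> exists2 c : R, 0 < c &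
      forall E, measurable E -> m E = (c%:E * mu E)%E) ->
  (forall m : {measure set (measurableTypeR R) -> \bar R},
    invariant_measure G m <-> exists2 c : R, 0 < c &
      forall E, measurable E -> m E = (c%:E * mu E)%E) ->
  same_invariant_measure F G.
Proof. by move=> muF hF hG; split; [exists mu|move=> m; rewrite hF hG]. Qed.

(** If [be = 0] the branch is constant on []0, 1[] with value [u], outside the third; if [be < 0]
    its denominator vanishes in []0, 1[]. This yields the positivity of the parameters. *)
Lemma moebius_den1_gt0 (R : realType) (X : 'I_3 -> 'M[R]_2) (F : R -> R)
    (j : 'I_3) (al be u v : R) :
  unit_map X F -> X j = moebius al be u v -> 0 < al -> ~ third j u -> 0 < be.
Proof.
move=> hF Xj al0 nu; have [_ /(_ j)[_ den _]] := hF.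
rewrite interior_itv in den.
rewrite ltNge le_eqVlt; apply/negP => /predU1P[be0|be0].
  have h01 : 0 < (1/2 : R) < 1 by lra.
  apply: nu; have [+ _] := F_flX hF j h01.
  rewrite Xj fl_moebius be0.
  have -> // : (al * u * (1 - 1/2) + 0 * v * (1/2)) / (al * (1 - 1/2) + 0 * (1/2)) = u.
  by field; rewrite gt_eqF.
have d0 : 0 < al - be by lra.
have y01 : 0 < al / (al - be) < 1.
  by rewrite divr_gt0//= ltr_pdivrMr//; lra.
have := den (al / (al - be)); rewrite /= in_itv /= => /(_ y01).
rewrite Xj fl_den_moebius => /eqP; apply.
by field; rewrite gt_eqF.
Qed.

(** * The four maps *)

Section parameters.
Variables (R : realType) (lam mu nu : R) (w1 w2 w3 : bool).

(** The booleans tell which branches are flipped, so that the four maps are treated at once.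
    Flipping exchanges [al] with [be] and [u] with [v]. *)
Let sel (w : bool) (a b : R) := if w then b else a.
Let al (j : 'I_3) := tnth [tuple sel w1 3 (3 * lam); sel w2 9 (3 * mu); sel w3 3 nu] j.
Let be (j : 'I_3) := tnth [tuple sel w1 (3 * lam) 3; sel w2 (3 * mu) 9; sel w3 nu 3] j.
Let u (j : 'I_3) := tnth [tuple sel w1 0 (1/3); sel w2 (1/3) (2/3); sel w3 (2/3) 1] j.
Let v (j : 'I_3) := tnth [tuple sel w1 (1/3) 0; sel w2 (2/3) (1/3); sel w3 1 (2/3)] j.

Definition flipped : 'I_3 -> 'M[R]_2 :=
  branches (if w1 then W1 lam else V1 lam) (if w2 then W2 mu else V2 mu)
    (if w3 then W3 nu else V3 nu).

Let flippedE j : flipped j = moebius (al j) (be j) (u j) (v j).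
Proof.
case: j => -[|[|[|//]]] lt; rewrite /flipped /branches /al /be /u /v
  (tnth_nth (V1 lam)) !(tnth_nth 0) /= /moebius /sel.
- by case: w1; rewrite /W1 /V1; congr mx2; field.
- by case: w2; rewrite /W2 /V2; congr mx2; field.
- by case: w3; rewrite /W3 /V3; congr mx2; field.
Qed.

Let uv j : (u j = j%:R / 3 /\ v j = j.+1%:R / 3) \/
           (u j = j.+1%:R / 3 /\ v j = j%:R / 3).
Proof.
case: j => -[|[|[|//]]] lt; rewrite /u /v !(tnth_nth 0) /= /sel.
- by case: w1; [right|left]; split; field.
- by case: w2; [right|left]; split; field.
- by case: w3; [right|left]; split; field.
Qed.

Hypotheses (lam0 : 0 < lam) (mu0 : 0 < mu) (nu0 : 0 < nu).

Let al0 j : 0 < al j.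
Proof.
case: j => -[|[|[|//]]] lt; rewrite /al !(tnth_nth 0) /= /sel;
  have := lam0; have := mu0; have := nu0.
- by case: w1 => /=; lra.
- by case: w2 => /=; lra.
- by case: w3 => /=; lra.
Qed.

Let be0 j : 0 < be j.
Proof.
case: j => -[|[|[|//]]] lt; rewrite /be !(tnth_nth 0) /= /sel;
  have := lam0; have := mu0; have := nu0.
- by case: w1 => /=; lra.
- by case: w2 => /=; lra.
- by case: w3 => /=; lra.
Qed.

Variable F : R -> R.
Hypothesis hF : unit_map flipped F.

Lemma ergodic_lam : ergodic F -> ~~ w1 -> lam <= 3.
Proof.
move=> eF nw.
have := ergodic_left al0 be0 uv flippedE hF eF.
by rewrite /u /al /be !(tnth_nth 0) /= /sel (negPf nw) => /(_ erefl); lra.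
Qed.

Lemma ergodic_nu : ergodic F -> ~~ w3 -> 1 <= nu.
Proof.
move=> eF nw.
have := ergodic_right al0 be0 uv flippedE hF eF.
rewrite /u /al /be !(tnth_nth 0) /= inordK//= /sel (negPf nw) => /(_ erefl).
lra.
Qed.

Variables (p s : R).
Hypotheses (p0 : 0 <= p) (s0 : 0 <= s).
(** These three equations are [sym] for the three branches, with the normalization [r = 1]. *)
Hypothesis eq1 : if w1 then lam * (2 + s) = 3 * p else 3 = lam * (2 * p + 1).
Hypothesis eq2 : if w2 then mu * (1 + 2 * s) = 3 * (2 * p + 1)
                 else 3 * (2 + s) = mu * (p + 2).
Hypothesis eq3 : if w3 then nu * s = p + 2 else 2 * s = nu - 1.

Let sym j : al j * (1 * (1 - u j) + s * u j) = be j * (p * (1 - v j) + 1 * v j).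
Proof.
case: j => -[|[|[|//]]] lt; rewrite /al /be /u /v !(tnth_nth 0) /= /sel.
- by case: w1 eq1 => /= e; lra.
- by case: w2 eq2 => /= e; lra.
- by case: w3 eq3 => /= e; lra.
Qed.

Lemma flipped_dual : has_natural_dual flipped F.
Proof. exact (has_dual al0 be0 uv flippedE hF p0 ltr01 s0 sym). Qed.

Lemma flipped_invariant : invariant_measure F (dual_measure p0 ltr01 s0).
Proof. exact (dual_measure_invariant al0 be0 uv flippedE hF p0 ltr01 s0 sym). Qed.

Lemma flipped_unique : ~~ (w1 && w3) -> ergodic F ->
  forall m : {measure set (measurableTypeR R) -> \bar R},
  invariant_measure F m <-> exists2 c : R, 0 < c &
    forall E, measurable E -> m E = (c%:E * dual_measure p0 ltr01 s0 E)%E.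
Proof.
move=> nw eF m; split.
  apply: (invariant_measure_unique al0 be0 uv flippedE hF p0 ltr01 s0 sym) => //.
  rewrite /u !(tnth_nth 0) /= inordK//= /sel.
  by case: w1 w3 nw => -[]//= _; [right|left|left].
move=> [c c0 mE].
exact: (invariant_scale al0 be0 uv flippedE hF c0 mE flipped_invariant).
Qed.

End parameters.

Unset Implicit Arguments.

Theorem theorem1 (R : realType) (lam mu nu : R) (T S1 S2 S3 : R -> R)
    (hT : unit_map (branches (V1 lam) (V2 mu) (V3 nu)) T)
    (hS1 : unit_map (branches (W1 lam) (V2 mu) (V3 nu)) S1)
    (hS2 : unit_map (branches (V1 lam) (W2 mu) (V3 nu)) S2)
    (hS3 : unit_map (branches (V1 lam) (V2 mu) (W3 nu)) S3)
    (eT : ergodic_with_invariant_measure T) :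
  [/\ ergodic_with_invariant_measure S1 ->
      lam * mu + mu = lam * nu + 3 * lam ->
      lam * mu * nu + 3 * lam * mu + 12 * mu = 9 * nu + 27 ->
      [/\ has_natural_dual (branches (V1 lam) (V2 mu) (V3 nu)) T,
          has_natural_dual (branches (W1 lam) (V2 mu) (V3 nu)) S1 &
          same_invariant_measure T S1],
      ergodic_with_invariant_measure S2 ->
      lam * mu + mu = lam * nu + 3 * lam ->
      lam * mu * nu = 9 ->
      [/\ has_natural_dual (branches (V1 lam) (V2 mu) (V3 nu)) T,
          has_natural_dual (branches (V1 lam) (W2 mu) (V3 nu)) S2 &
          same_invariant_measure T S2] &
      ergodic_with_invariant_measure S3 ->
      lam * mu + mu = lam * nu + 3 * lam ->
      4 * (lam * nu) - mu * nu - lam * mu * nu + 3 * lam + 3 = 0 ->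
      [/\ has_natural_dual (branches (V1 lam) (V2 mu) (V3 nu)) T,
          has_natural_dual (branches (V1 lam) (V2 mu) (W3 nu)) S3 &
          same_invariant_measure T S3]].
Proof.
have lam0 : 0 < lam.
  have Xj : branches (V1 lam) (V2 mu) (V3 nu) ord0 =
      moebius 3 (3 * lam) 0 (1/3).
    by rewrite /branches (tnth_nth (V1 lam)) /= /V1 /moebius; congr mx2; field.
  have n3 : ~ third (ord0 : 'I_3) (0 : R) by move/in_third => /=; lra.
  by have := moebius_den1_gt0 hT Xj (ltr0n _ 3) n3; lra.
have mu0 : 0 < mu.
  have Xj : branches (V1 lam) (V2 mu) (V3 nu) (inord 1) =
      moebius 9 (3 * mu) (1/3) (2/3).
    by rewrite /branches (tnth_nth (V1 lam)) /= inordK//= /V2 /moebius;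
      congr mx2; field.
  have n3 : ~ third (inord 1 : 'I_3) (1/3 : R).
    by move/in_third; rewrite inordK//=; lra.
  by have := moebius_den1_gt0 hT Xj (ltr0n _ 9) n3; lra.
have nu0 : 0 < nu.
  have Xj : branches (V1 lam) (V2 mu) (V3 nu) (inord 2) =
      moebius 3 nu (2/3) 1.
    by rewrite /branches (tnth_nth (V1 lam)) /= inordK//= /V3 /moebius;
      congr mx2; field.
  have n3 : ~ third (inord 2 : 'I_3) (2/3 : R).
    by move/in_third; rewrite inordK//=; lra.
  exact: moebius_den1_gt0 hT Xj (ltr0n _ 3) n3.
have {}eT : ergodic T by case: eT.
have lam3 : lam <= 3.
  exact: (@ergodic_lam _ lam mu nu false false false lam0 mu0 nu0 T hT eT).
have nu1 : 1 <= nu.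
  exact: (@ergodic_nu _ lam mu nu false false false lam0 mu0 nu0 T hT eT).
(* The first and third branches of [T] determine [p] and [s]; the bounds [lam <= 3] and [1 <= nu]
   make them nonnegative. *)
have [p p0 pE] : exists2 p : R, 0 <= p & 2 * lam * p = 3 - lam.
  exists ((3 - lam) / (2 * lam)); first by rewrite divr_ge0//; lra.
  by field; rewrite gt_eqF.
have [s s0 sE] : exists2 s : R, 0 <= s & 2 * s = nu - 1.
  by exists ((nu - 1) / 2); lra.
have T1 : 3 = lam * (2 * p + 1) by lra.
(* With these values the equation of the second branch is the first condition of each case. *)
have T2 : lam * mu + mu = lam * nu + 3 * lam -> 3 * (2 + s) = mu * (p + 2).
  move=> h; apply: (mulfI (_ : 2 * lam != 0)); first by rewrite gt_eqF//; lra.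
  have := congr1 ( *%R mu) pE; have := congr1 ( *%R lam) sE; lra.
have dual T' w1 w2 w3 (h : unit_map (flipped lam mu nu w1 w2 w3) T') e1 e2 e3 :=
  @flipped_dual _ lam mu nu w1 w2 w3 lam0 mu0 nu0 T' h p s p0 s0 e1 e2 e3.
have inv T' w1 w2 w3 (h : unit_map (flipped lam mu nu w1 w2 w3) T') e1 e2 e3 :=
  @flipped_invariant _ lam mu nu w1 w2 w3 lam0 mu0 nu0 T' h p s p0 s0 e1 e2 e3.
have uniq T' w1 w2 w3 (h : unit_map (flipped lam mu nu w1 w2 w3) T') e1 e2 e3 :=
  @flipped_unique _ lam mu nu w1 w2 w3 lam0 mu0 nu0 T' h p s p0 s0 e1 e2 e3.
split=> -[eS _] h1 h2.
(* The multipliers make [mu * (1 + lam) * (lam * (nu + 3) + 12)] appear in both [h1] and [h2], which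
   eliminates [mu]; a common factor [nu + 3] is then cancelled. *)
- have E1 : lam * (2 + s) = 3 * p.
    apply: (mulfI (_ : 2 * lam != 0)); first by rewrite gt_eqF//; lra.
    apply: (mulfI (_ : nu + 3 != 0)); first by rewrite gt_eqF//; lra.
    have a1 := congr1 ( *%R (lam * (nu + 3) + 12)) h1.
    have a2 := congr1 ( *%R (1 + lam)) h2.
    have a3 := congr1 ( *%R (nu + 3)) pE.
    have a4 := congr1 ( *%R (lam * lam * (nu + 3))) sE.
    lra.
  split.
  + exact (dual T false false false hT T1 (T2 h1) sE).
  + exact (dual S1 true false false hS1 E1 (T2 h1) sE).
  + apply: (same_invariant_measure_of_unique (mu := dual_measure p0 ltr01 s0)).
    * exact (inv T false false false hT T1 (T2 h1) sE).
    * exact (uniq T false false false hT T1 (T2 h1) sE isT eT).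
    * exact (uniq S1 true false false hS1 E1 (T2 h1) sE isT eS).
(* As [1 + 2 * s = nu] and [lam * (2 * p + 1) = 3], this is [lam * mu * nu = 9]. *)
- have E2 : mu * (1 + 2 * s) = 3 * (2 * p + 1).
    apply: (mulfI (_ : lam != 0)); first by rewrite gt_eqF.
    have a1 := congr1 ( *%R (lam * mu)) sE; lra.
  split.
  + exact (dual T false false false hT T1 (T2 h1) sE).
  + exact (dual S2 false true false hS2 T1 E2 sE).
  + apply: (same_invariant_measure_of_unique (mu := dual_measure p0 ltr01 s0)).
    * exact (inv T false false false hT T1 (T2 h1) sE).
    * exact (uniq T false false false hT T1 (T2 h1) sE isT eT).
    * exact (uniq S2 false true false hS2 T1 E2 sE isT eS).
(* [nu] times [h1] eliminates [mu] from [h2], leaving [lam * nu * (nu - 1) = 3 * lam + 3]. *)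
- have E3 : nu * s = p + 2.
    apply: (mulfI (_ : 2 * lam != 0)); first by rewrite gt_eqF//; lra.
    have a1 := congr1 ( *%R nu) h1.
    have a2 := congr1 ( *%R (lam * nu)) sE; lra.
  split.
  + exact (dual T false false false hT T1 (T2 h1) sE).
  + exact (dual S3 false false true hS3 T1 (T2 h1) E3).
  + apply: (same_invariant_measure_of_unique (mu := dual_measure p0 ltr01 s0)).
    * exact (inv T false false false hT T1 (T2 h1) sE).
    * exact (uniq T false false false hT T1 (T2 h1) sE isT eT).
    * exact (uniq S3 false false true hS3 T1 (T2 h1) E3 isT eS).
Qed.
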